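(* Let $m\geq1$ be an integer and let $A_{m}=\{1,\sqrt{2},\dots,\sqrt{m}\}$. For any integer $l>1$ and any integer $k\geq1$, \[ \chi_{k}(\mathbb{R}^{n},A_{m})\geq\left(\max_{0<t<1}\frac{\theta\left(t^{\frac{k}{m+1}};l\right)}{1+t+\cdots+t^{l-1}}+o(1)\right)^{n}, \] where $o(1)$ denotes a quantity tending to $0$ as $n\to\infty$ (with $m,k,l$ fixed).
   Context: For a finite set $A\subset\mathbb{R}_{>0}$, $G_{A}(\mathbb{R}^{n})$ is the graph with vertex set $\mathbb{R}^{n}$ in which $x,y$ are adjacent iff $\|x-y\|_{2}\in A$. For a graph $G$, $\chi_{k}(G)$ is the minimum number of colors needed to color $G$ so that no color class contains a $(k+1)$-clique, and $\chi_{k}(\mathbb{R}^{n},A)=\chi_{k}(G_{A}(\mathbb{R}^{n}))$. The truncated theta function is $\theta(t;l)=\sum_{j=1}^{l}t^{\binom{j}{2}}=1+t+t^{3}+t^{6}+\cdots+t^{\binom{l}{2}}$. *)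

(* Defs.v *)
From HB Require Import structures.
From mathcomp Require Import all_boot all_order all_algebra.
From mathcomp Require Import all_classical all_reals all_analysis.

Set Implicit Arguments.
Unset Strict Implicit.
Unset Printing Implicit Defensive.

Import Order.TTheory GRing.Theory Num.Theory.
Import numFieldNormedType.Exports.

Local Open Scope classical_set_scope.
Local Open Scope ring_scope.

(* A graph is given by its vertex type [V] and its adjacency relation
   [E : V -> V -> Prop]. *)

Definition clique_in (V : Type) (E : V -> V -> Prop) (S : set V) (q : nat) : Prop :=
  exists g : 'I_q -> V,
    [/\ injective g,
        forall i, S (g i) &
        forall i j, i != j -> E (g i) (g j)].

Definition k_colorable (V : Type) (E : V -> V -> Prop) (k c : nat) : Prop :=
  exists f : V -> 'I_c, forall a : 'I_c, ~ clique_in E (f @^-1` [set a]) k.+1.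

(* The least [c] with [k_colorable E k c]; an infimum of natural numbers is a
   minimum as soon as it is finite, and the value is [+oo] when no finite
   number of colors suffices. *)
Definition chi_k (R : realType) (k : nat) (V : Type) (E : V -> V -> Prop) : \bar R :=
  ereal_inf [set c%:R%:E | c in [set c : nat | k_colorable E k c]].

(* The norm [`|_|] of the library on row vectors is the sup norm. *)
Definition enorm2 (R : realType) (n : nat) (x : 'rV[R]_n) : R :=
  Num.sqrt (\sum_(i < n) x 0 i ^+ 2).

Definition dist_graph (R : realType) (n : nat) (A : set R) (x y : 'rV[R]_n) : Prop :=
  A (enorm2 (x - y)).

Definition chi_k_Rn (R : realType) (k n : nat) (A : set R) : \bar R :=
  chi_k R k (@dist_graph R n A).

Definition sqrt_dists (R : realType) (m : nat) : set R :=
  [set Num.sqrt j%:R | j in [set j : nat | (1 <= j <= m)%N]].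
Arguments sqrt_dists : clear implicits.

Definition theta_trunc (R : realType) (t : R) (l : nat) : R :=
  \sum_(1 <= j < l.+1) t ^+ 'C(j, 2).

Definition theta_ratio (R : realType) (m k l : nat) (t : R) : R :=
  theta_trunc (t `^ (k%:R / (m.+1)%:R)) l / \sum_(0 <= i < l) t ^+ i.

(* For [k <= m] this supremum is an attained maximum.  For [k > m] the ratio is
   at most 1 on ]0, 1[ and tends to 1 at both endpoints, so the supremum is 1,
   but in general it is not attained. *)
Definition theta_max (R : realType) (m k l : nat) : R :=
  sup [set theta_ratio m k l t | t in [set t : R | 0 < t < 1]].

(* Main.v *)
Require Import Defs.
From mathcomp Require Import all_boot all_order all_algebra.
From mathcomp Require Import all_classical all_reals all_analysis.
From mathcomp Require Import finfield.
From mathcomp Require Import ring lra zify.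
Import Order.TTheory GRing.Theory Num.Theory.
Import numFieldNormedType.Exports.
Local Open Scope ring_scope.
Set Implicit Arguments.
Unset Strict Implicit.

(* The vertices are the words x over the first l integers of 0, 1, -1, 2, -2,
   and so on, on a sphere with |x|^2 = N and of given weight B = 2 N - sum x_i.  For
   two of them |x - y|^2 = 2 (N - <x, y>) with 0 <= N - <x, y> <= B, so if p is a
   prime with B < (m + 1) p, the vectors x / sqrt (2 p) are at a distance in A_m
   as soon as p divides N - <x, y> and x <> y.

   If S contains no (k+1)-clique, remove maximal cliques C from it one after the
   other.  Modulo p the polynomial prod_(c in C) (1 - (N - <c, y>)^(p-1)) is
   nonzero on what remains of S exactly at the points of C, hence these
   polynomials are independent, and |S| is at most k times the number of
   monomials of degree at most k (p - 1) with all exponents below l.  Generating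
   functions in t for the monomials and in t^(k/(m+1)) for the words turn this into
   the stated bound, provided that p is asymptotic to B / (m + 1).

   That such primes exist, i.e. that ratios of consecutive primes tend to 1, is
   derived from Selberg's formula, following Erdos: a gap of ratio lam forces
   most intervals (x/n, lam x/n] to have the maximal density 2; two overlapping
   ones give a longer interval of density 2, which in turn forces a
   longer gap.  Iterating contradicts Mertens' estimate. *)

(** * Divisor sums *)

Lemma sum_dvdn_divisors (V : nmodType) (N n : nat) (f : nat -> V) :
  (0 < n <= N)%N ->
  \sum_(1 <= d < N.+1 | (d %| n)%N) f d = \sum_(d <- divisors n) f d.
Proof.
move=> /andP[n0 nN]; rewrite -big_filter; apply: perm_big.
apply: uniq_perm; [by rewrite filter_uniq ?iota_uniq | exact: divisors_uniq|].
move=> d; rewrite mem_filter mem_index_iota -dvdn_divisors //.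
by case dn: (d %| n)%N => //=; move: (dvdn_leq n0 dn) (dvdn_gt0 n0 dn); lia.
Qed.

(** Each divisor of p^a m is p^i d for exactly one pair with i <= a and d | m: i is its p-adic
    valuation and d the cofactor. *)
Lemma sum_divisors_pfactor (V : nmodType) (p a m : nat) (f : nat -> V) :
  prime p -> coprime p m -> (0 < m)%N ->
  \sum_(d <- divisors (p ^ a * m)) f d =
  \sum_(i < a.+1) \sum_(d <- divisors m) f (p ^ i * d)%N.
Proof.
move=> pp cpm m0.
have pa0 i : (0 < p ^ i)%N by rewrite expn_gt0 prime_gt0.
have dm0 d : d \in divisors m -> (0 < d)%N /\ coprime p d.
  by rewrite -dvdn_divisors // => dm; split;
    [exact: dvdn_gt0 dm | exact: coprime_dvdr dm cpm].
rewrite -(big_mkord xpredT (fun i => \sum_(d <- divisors m) f (p ^ i * d)%N)).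
transitivity (\sum_(x <- [seq (p ^ x.1 * x.2)%N | x <-
  [seq (i, d) | i <- index_iota 0 a.+1, d <- divisors m]]) f x); last first.
  by rewrite big_map big_allpairs_dep.
apply: perm_big; apply: uniq_perm.
- exact: divisors_uniq.
- rewrite map_inj_in_uniq; last first.
    move=> [i d] [j e] /allpairsPdep[i1 [d1 [_ hd [-> ->]]]].
    move=> /allpairsPdep[j1 [e1 [_ he [-> ->]]]] /= E.
    have [d0 cd] := dm0 _ hd; have [e0 ce] := dm0 _ he.
    have eij : i1 = j1.
      have := congr1 (logn p) E; rewrite !lognM ?pa0 // !pfactorK //.
      by rewrite (logn_coprime cd) (logn_coprime ce) !addn0.
    by move: E; rewrite eij => /eqP; rewrite eqn_pmul2l // => /eqP ->.
  by apply: allpairs_uniq; [exact: iota_uniq | exact: divisors_uniq | move=> [? ?] [? ?]].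
move=> d; apply/idP/idP.
  rewrite -dvdn_divisors ?muln_gt0 ?pa0 // => dn.
  have d0 : (0 < d)%N by apply: dvdn_gt0 dn; rewrite muln_gt0 pa0.
  have [e ce E] := pfactor_coprime pp d0.
  apply/mapP; exists (logn p d, e); last by rewrite /= mulnC.
  apply/allpairsPdep; exists (logn p d), e; split=> //=.
    rewrite mem_index_iota /= ltnS.
    have := dvdn_leq_log p _ dn; rewrite muln_gt0 pa0 m0 lognM ?pa0 // pfactorK //.
    by rewrite (logn_coprime cpm) addn0; apply.
  rewrite -dvdn_divisors //.
  have ed : (e %| p ^ a * m)%N by apply: dvdn_trans dn; rewrite E dvdn_mulr.
  by rewrite Gauss_dvdr // in ed; rewrite coprime_sym; apply: coprimeXl.
move=> /mapP[[i e] /allpairsPdep[i1 [e1 [hi he [-> ->]]]] ->] /=.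
rewrite -dvdn_divisors ?muln_gt0 ?pa0 //; apply: dvdn_mul.
  by apply: dvdn_exp2l; move: hi; rewrite mem_index_iota ltnS.
by rewrite dvdn_divisors.
Qed.

Definition mobius (R : realType) (n : nat) : R :=
  \prod_(p <- primes n) (if logn p n == 1%N then -1 else 0).

Definition mangoldt (R : realType) (n : nat) : R :=
  if size (primes n) == 1%N then ln (pdiv n)%:R else 0.

Lemma perm_primes_pfactor (p a m : nat) :
  prime p -> coprime p m -> (0 < m)%N -> (0 < a)%N ->
  perm_eq (primes (p ^ a * m)) (p :: primes m).
Proof.
move=> pp cpm m0 a0; apply: uniq_perm; first exact: primes_uniq.
  by rewrite /= primes_uniq mem_primes pp m0 /= andbT -prime_coprime.
move=> q; rewrite primesM ?expn_gt0 ?(prime_gt0 pp) // in_cons.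
by rewrite (primesX _ a0) (primes_prime pp) mem_seq1.
Qed.

Lemma mobius_pfactor (R : realType) (p a m : nat) :
  prime p -> coprime p m -> (0 < m)%N -> (0 < a)%N ->
  mobius R (p ^ a * m) = (if a == 1%N then -1 else 0) * mobius R m.
Proof.
move=> pp cpm m0 a0; have pa0 : (0 < p ^ a)%N by rewrite expn_gt0 prime_gt0.
rewrite /mobius (perm_big _ (perm_primes_pfactor pp cpm m0 a0)) big_cons.
rewrite lognM // pfactorK // (logn_coprime cpm) addn0; congr (_ * _).
apply: eq_big_seq => q; rewrite mem_primes => /and3P[pq _ qm].
have qp : q != p by apply: contraTneq cpm => <-; rewrite prime_coprime // qm.
by rewrite lognM // lognX logn_prime // (negPf qp) muln0.
Qed.

Lemma mobius1 (R : realType) : mobius R 1 = 1.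
Proof. by rewrite /mobius big_nil. Qed.

Lemma norm_mobius_le1 (R : realType) (n : nat) : `|mobius R n| <= 1.
Proof.
rewrite /mobius; elim: (primes n) => [|p s IH]; first by rewrite big_nil normr1.
rewrite big_cons normrM; apply: mulr_ile1 => //.
by case: ifP; rewrite ?normrN1 ?normr0.
Qed.

Lemma mangoldt_ge0 (R : realType) (n : nat) : 0 <= mangoldt R n.
Proof. by rewrite /mangoldt; case: ifP => // _; rewrite ln_ge0 // ler1n pdiv_gt0. Qed.

Lemma mangoldt_pfactor (R : realType) (p a m : nat) :
  prime p -> coprime p m -> (0 < m)%N -> (0 < a)%N ->
  mangoldt R (p ^ a * m) = if m == 1%N then ln p%:R else 0.
Proof.
move=> pp cpm m0 a0; rewrite /mangoldt (perm_size (perm_primes_pfactor pp cpm m0 a0)) /=.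
rewrite eqSS size_eq0; case: (ltngtP m 1) m0 => // [m1|->] _; last first.
  by case: a a0 => // a _; rewrite muln1 pdiv_pfactor.
by rewrite primes_eq0 ltnNge m1.
Qed.

Lemma mangoldt1 (R : realType) : mangoldt R 1 = 0.
Proof. by []. Qed.

(** Splitting off the full power of the smallest prime divisor leaves a smaller cofactor. With
    [sum_divisors_pfactor] this computes the divisor sums below. *)
Lemma pfactor_ind (P : nat -> Prop) :
  P 1%N ->
  (forall p a m, prime p -> coprime p m -> (0 < m)%N -> (0 < a)%N -> P m -> P (p ^ a * m)%N) ->
  forall n, (0 < n)%N -> P n.
Proof.
move=> P1 Pp n; elim/ltn_ind: n => n IH n0.
have [n1|n1] := leqP n 1; first by rewrite (_ : n = 1%N) //; lia.
have pp := pdiv_prime n1.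
have [m cpm E] := pfactor_coprime pp n0.
have a0 : (0 < logn (pdiv n) n)%N by rewrite logn_gt0 mem_primes pp n0 pdiv_dvd.
have m0 : (0 < m)%N by move: n0; rewrite E; case: m {cpm E}.
rewrite E mulnC; apply: Pp => //; apply: IH => //.
rewrite E -{1}[m]muln1 ltn_pmul2l //.
by rewrite -(exp1n (logn (pdiv n) n)) ltn_exp2r // prime_gt1.
Qed.

Lemma mobius_pfactor_ge2 (R : realType) (p i d : nat) :
  prime p -> coprime p d -> (0 < d)%N -> mobius R (p ^ i.+2 * d) = 0.
Proof. by move=> pp cpd d0; rewrite mobius_pfactor // mul0r. Qed.

(** Only the exponents 0 and 1 of p contribute, and mu(p d) = - mu(d), so the two inner sums
    cancel. *)
Lemma sum_mobius (R : realType) (n : nat) : (0 < n)%N ->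
  \sum_(d <- divisors n) mobius R d = (n == 1%N)%:R.
Proof.
move: n; apply: pfactor_ind; first by rewrite big_seq1 mobius1.
move=> p [//|a] m pp cpm m0 _ _; rewrite sum_divisors_pfactor //.
have pm : (p ^ a.+1 * m == 1)%N = false.
  by apply/negbTE; rewrite muln_eq1 negb_and expnS muln_eq1 (gtn_eqF (prime_gt1 pp)).
rewrite pm big_ord_recl big_ord_recl [X in _ + (_ + X)]big1 ?addr0; last first.
  move=> i _; rewrite big1_seq // => d; rewrite -dvdn_divisors // => /andP[_ dm].
  by rewrite mobius_pfactor_ge2 ?(coprime_dvdr dm cpm) ?(dvdn_gt0 m0 dm).
rewrite -big_split /= big1_seq // => d; rewrite -dvdn_divisors // => /andP[_ dm].
by rewrite mul1n mobius_pfactor ?(coprime_dvdr dm cpm) ?(dvdn_gt0 m0 dm) //= mulN1r addrN.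
Qed.

(** The terms of d and p d combine to - mu(d) ln p, so the sum is - ln p times the Moebius sum over
    the divisors of m, which vanishes unless m = 1. *)
Lemma sum_mobius_ln (R : realType) (n : nat) : (0 < n)%N ->
  \sum_(d <- divisors n) mobius R d * ln d%:R = - mangoldt R n.
Proof.
move: n; apply: pfactor_ind; first by rewrite big_seq1 ln1 mulr0 mangoldt1 oppr0.
move=> p [//|a] m pp cpm m0 _ _; rewrite sum_divisors_pfactor //.
rewrite big_ord_recl big_ord_recl [X in _ + (_ + X)]big1 ?addr0; last first.
  move=> i _; rewrite big1_seq // => d; rewrite -dvdn_divisors // => /andP[_ dm].
  by rewrite mobius_pfactor_ge2 ?mul0r ?(coprime_dvdr dm cpm) ?(dvdn_gt0 m0 dm).
rewrite -big_split /= mangoldt_pfactor //.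
transitivity (- (ln p%:R * \sum_(d <- divisors m) mobius R d)); last first.
  by rewrite sum_mobius //; case: eqP => _; rewrite ?mulr1 ?mulr0.
rewrite mulr_sumr -sumrN; apply: eq_big_seq => d; rewrite -dvdn_divisors // => dm.
have d0 := dvdn_gt0 m0 dm.
rewrite mul1n mobius_pfactor ?(coprime_dvdr dm cpm) //= natrM expn1.
by rewrite lnM ?posrE ?ltr0n ?(prime_gt0 pp) //; ring.
Qed.

Lemma sum_mangoldt (R : realType) (n : nat) : (0 < n)%N ->
  \sum_(d <- divisors n) mangoldt R d = ln n%:R.
Proof.
move: n; apply: pfactor_ind; first by rewrite big_seq1 mangoldt1 ln1.
move=> p a m pp cpm m0 a0 IH; rewrite sum_divisors_pfactor // big_ord_recl.
under eq_bigr do rewrite expn0 mul1n.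
rewrite IH natrM natrX lnM ?posrE ?exprn_gt0 ?ltr0n ?(prime_gt0 pp) //.
rewrite lnXn ?ltr0n ?(prime_gt0 pp) //.
rewrite addrC; congr (_ + _); rewrite -[a in RHS]card_ord -sumr_const.
apply: eq_bigr => i _ /=.
have m1 : 1%N \in divisors m by rewrite -dvdn_divisors ?dvd1n.
rewrite (bigD1_seq 1%N m1 (divisors_uniq m)) /= big1_seq ?addr0.
  by rewrite mangoldt_pfactor // coprimen1.
move=> d; rewrite -dvdn_divisors // => /andP[/negPf d1 dm].
by rewrite mangoldt_pfactor ?d1 ?(coprime_dvdr dm cpm) ?(dvdn_gt0 m0 dm) //.
Qed.

Lemma sum_multiples (V : nmodType) (N n : nat) (F : nat -> V) : (0 < n)%N ->
  \sum_(1 <= m < (N %/ n).+1) F (n * m)%N =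
  \sum_(1 <= r < N.+1 | (n %| r)%N) F r.
Proof.
move=> n0; rewrite -[RHS]big_filter -(big_map (fun m => n * m)%N xpredT F).
apply: perm_big; apply: uniq_perm.
- by rewrite map_inj_uniq ?iota_uniq // => x y /eqP; rewrite eqn_pmul2l // => /eqP.
- by rewrite filter_uniq ?iota_uniq.
move=> r; rewrite mem_filter mem_index_iota; apply/mapP/idP.
  move=> [m]; rewrite mem_index_iota => /andP[m0]; rewrite ltnS leq_divRL // => h ->.
  by rewrite dvdn_mulr // muln_gt0 n0 m0 ltnS mulnC.
move=> /and3P[/dvdnP[m ->]]; rewrite muln_gt0 ltnS => /andP[m0 _] h.
by exists m; [rewrite mem_index_iota m0 ltnS leq_divRL | rewrite mulnC].
Qed.

(** Both sides run over the pairs (n, m) with n m <= N, grouped by n on the left and by the product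
    r on the right. *)
Lemma exchange_sum_multiples (R : realType) (N : nat) (g F : nat -> R) :
  \sum_(1 <= n < N.+1) g n * \sum_(1 <= m < (N %/ n).+1) F (n * m)%N =
  \sum_(1 <= r < N.+1) F r * \sum_(d <- divisors r) g d.
Proof.
under eq_big_nat => n /andP[n0 _] do rewrite sum_multiples // mulr_sumr.
rewrite [LHS](eq_bigr (fun n => \sum_(1 <= r < N.+1) if (n %| r)%N then g n * F r else 0));
  last by move=> n _; rewrite big_mkcond.
rewrite exchange_big_nat /=; apply: eq_big_nat => r /andP[r0 rN].
rewrite -big_mkcond /= -(@sum_dvdn_divisors _ N) ?r0 // mulr_sumr.
by apply: eq_bigr => n _; rewrite mulrC.
Qed.

(** * Selberg's formula *)

Lemma ln_sub_le (R : realType) (x y : R) : 0 < x -> 0 < y -> ln y - ln x <= (y - x) / x.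
Proof.
move=> x0 y0; rewrite -lnV ?posrE // -lnM ?posrE ?invr_gt0 //.
have yx : 0 < y / x by rewrite divr_gt0.
have -> : (y - x) / x = y / x - 1 by rewrite mulrBl divff // gt_eqF.
rewrite -{1}[y / x](addrNK 1) addrC; apply: le_ln1Dx; lra.
Qed.

Lemma le_ln_id (R : realType) (x : R) : 0 < x -> ln x <= x.
Proof. by move=> x0; have := ln_sub_le ltr01 x0; rewrite ln1; lra. Qed.

Definition sum_ln (R : realType) (N : nat) : R := \sum_(1 <= r < N.+1) ln r%:R.

Definition chebyshev_psi (R : realType) (N : nat) : R := \sum_(1 <= n < N.+1) mangoldt R n.

Lemma chebyshev_psi_ge0 (R : realType) (N : nat) : 0 <= chebyshev_psi R N.
Proof. by apply: sumr_ge0 => n _; exact: mangoldt_ge0. Qed.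

Lemma le_chebyshev_psi (R : realType) (M N : nat) :
  (M <= N)%N -> chebyshev_psi R M <= chebyshev_psi R N.
Proof.
move=> MN; rewrite /chebyshev_psi (@big_cat_nat _ _ _ M.+1 1 N.+1) //= lerDl.
by apply: sumr_ge0 => n _; exact: mangoldt_ge0.
Qed.

Lemma sum_ln_mangoldt (R : realType) (N : nat) :
  sum_ln R N = \sum_(1 <= d < N.+1) mangoldt R d * (N %/ d)%:R.
Proof.
have := exchange_sum_multiples N (mangoldt R) (fun _ => 1).
under eq_bigr do rewrite sumr_const_nat subn1 /=.
move=> ->; apply: eq_big_nat => r /andP[r0 _]; by rewrite sum_mangoldt // mul1r.
Qed.

Lemma exchange_hyperbola (V : nmodType) (M : nat) (G : nat -> nat -> V) :
  \sum_(1 <= m < M.+1) \sum_(1 <= d < (M %/ m).+1) G m d =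
  \sum_(1 <= d < M.+1) \sum_(1 <= m < (M %/ d).+1) G m d.
Proof.
have H (F : nat -> V) m : (0 < m)%N ->
    \sum_(1 <= d < (M %/ m).+1) F d = \sum_(1 <= d < M.+1) if (d * m <= M)%N then F d else 0.
  move=> m0; rewrite (@big_nat_widen _ _ _ _ _ M.+1) ?ltnS ?leq_div // -big_mkcond /=.
  by apply: eq_bigl => d; rewrite ltnS leq_divRL.
under eq_big_nat => m /andP[m0 _] do rewrite H //.
rewrite exchange_big_nat /=; apply: eq_big_nat => d /andP[d0 _].
by rewrite H //; apply: eq_bigr => m _; rewrite mulnC.
Qed.

Lemma sum_chebyshev_psi (R : realType) (M : nat) :
  \sum_(1 <= m < M.+1) chebyshev_psi R (M %/ m) = sum_ln R M.
Proof.
rewrite exchange_hyperbola sum_ln_mangoldt; apply: eq_bigr => d _.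
by rewrite sumr_const_nat subn1 /= mulr_natr.
Qed.

Lemma sum_ln_bounds (R : realType) (N : nat) : (0 < N)%N ->
  N%:R * ln N%:R - N%:R <= sum_ln R N <= N%:R * ln N%:R - N%:R + ln N%:R + 1.
Proof.
case: N => // N _; elim: N => [|N IH].
  by rewrite /sum_ln big_nat1 ln1; lra.
rewrite /sum_ln big_nat_recr //= -/(sum_ln R N.+1).
have n0 : (0 : R) < N.+1%:R by rewrite ltr0n.
have n1 : (0 : R) < N.+2%:R by rewrite ltr0n.
have h1 := ln_sub_le n0 n1; have h2 := ln_sub_le n1 n0.
have E : N.+2%:R = N.+1%:R + 1 :> R by rewrite -[N.+2]addn1 natrD.
rewrite E in h1 h2 n1 *; set n : R := N.+1%:R in h1 h2 n0 n1 IH *.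
have h1' : (ln (n + 1) - ln n) * n <= 1.
  by rewrite -ler_pdivlMr //; apply: le_trans h1 _; rewrite ler_pM2r ?invr_gt0 //; lra.
have h2' : (ln n - ln (n + 1)) * (n + 1) <= -1.
  by rewrite -ler_pdivlMr //; apply: le_trans h2 _; rewrite ler_pM2r ?invr_gt0 //; lra.
lra.
Qed.

(** In ln N! - 2 ln floor(N/2)! the coefficient of Lambda(d) is floor(N/d) - 2 floor(floor(N/2)/d),
    which is never negative and is at least 1 for N/2 < d <= N. *)
Lemma chebyshev_psi_half (R : realType) (N : nat) :
  chebyshev_psi R N - chebyshev_psi R (N %/ 2) <= sum_ln R N - 2 * sum_ln R (N %/ 2).
Proof.
have hN : (N %/ 2 <= N)%N by rewrite leq_div.
have E : sum_ln R (N %/ 2) = \sum_(1 <= d < N.+1) mangoldt R d * (N %/ 2 %/ d)%:R.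
  rewrite sum_ln_mangoldt (@big_cat_nat _ _ _ (N %/ 2).+1 1 N.+1) //= [X in _ = _ + X]big1_seq ?addr0 //.
  by move=> d; rewrite mem_index_iota => /andP[_ /andP[d1 _]]; rewrite divn_small ?mulr0.
rewrite {1}/chebyshev_psi (@big_cat_nat _ _ _ (N %/ 2).+1 1 N.+1) //=.
rewrite -/(chebyshev_psi R (N %/ 2)) addrAC subrr add0r.
rewrite sum_ln_mangoldt E mulr_sumr -sumrB.
rewrite (@big_cat_nat _ _ _ (N %/ 2).+1 1 N.+1) //= -[leLHS]add0r lerD //.
  apply: sumr_ge0 => d _; rewrite mulrCA -mulrBr mulr_ge0 ?mangoldt_ge0 //.
  by rewrite subr_ge0 -natrM ler_nat divnAC mulnC leq_trunc_div.
apply: ler_sum_nat => d /andP[d1 d2]; rewrite (divn_small d1) !mulr0 subr0.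
rewrite -[leLHS]mulr1 ler_wpM2l ?mangoldt_ge0 // ler1n divn_gt0 //; lia.
Qed.

Lemma chebyshev_psi_le (R : realType) (N : nat) : chebyshev_psi R N <= 20 * N%:R.
Proof.
elim/ltn_ind: N => N IH; have [N1|N2] := leqP N 1.
  case: N N1 {IH} => [|[|//]] _; rewrite /chebyshev_psi; first by rewrite big_geq // mulr0.
  by rewrite big_nat1 mangoldt1; lra.
have h := chebyshev_psi_half R N; have ih := IH (N %/ 2)%N ltac:(lia).
set H := (N %/ 2)%N in h ih *.
have N0 : (0 < N)%N by lia.
have H0 : (0 < H)%N by lia.
have /andP[_ T1] := sum_ln_bounds R N0; have /andP[T2 _] := sum_ln_bounds R H0.
have rN : (0 : R) < N%:R by rewrite ltr0n.
have rH : (1 : R) <= H%:R by rewrite ler1n.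
have rH0 : (0 : R) < H%:R by lra.
have NH : (N%:R : R) <= 2 * H%:R + 1 by rewrite -natrM natr1 ler_nat; lia.
have HN : (2 * H%:R : R) <= N%:R by rewrite -natrM ler_nat; lia.
have l1 := le_ln_id rN; have l2 := le_ln_id rH0.
have d := ln_sub_le rH0 rN; rewrite ler_pdivlMr // in d.
have lH : 0 <= ln H%:R :> R by rewrite ln_ge0.
have : (N%:R - 2 * H%:R) * ln H%:R <= ln H%:R :> R by rewrite ler_piMl //; lra.
have lNH : 0 <= ln N%:R - ln H%:R :> R by rewrite subr_ge0 ler_ln ?posrE //; lra.
(* This uses N <= 3 H and ln N - ln H <= (N - H) / H. *)
have : N%:R * (ln N%:R - ln H%:R) <= 3 * (N%:R - H%:R) :> R.
  apply: le_trans (_ : 3 * H%:R * (ln N%:R - ln H%:R) <= _); last by lra.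
  by rewrite ler_wpM2r //; lra.
lra.
Qed.

(** Replacing floor(N/d) by N/d in [sum_ln_mangoldt] costs at most psi(N) = O(N); after division by
    N, the estimate of ln N! leaves a bounded error. *)
Lemma mertens (R : realType) : exists2 K : R, 0 <= K &
  forall N, (0 < N)%N -> `|\sum_(1 <= d < N.+1) mangoldt R d / d%:R - ln N%:R| <= K.
Proof.
exists 22; first by lra.
move=> N N0; set S := \sum_(1 <= d < N.+1) _.
have n0 : (0 : R) < N%:R by rewrite ltr0n.
have /andP[T1 T2] := sum_ln_bounds R N0.
have e := sum_ln_mangoldt R N; have cp := chebyshev_psi_le R N.
have ES : N%:R * S = \sum_(1 <= d < N.+1) mangoldt R d * (N%:R / d%:R).
  by rewrite mulr_sumr; apply: eq_bigr => d _; rewrite mulrCA.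
have up : sum_ln R N <= N%:R * S.
  rewrite e ES; apply: ler_sum_nat => d /andP[d0 _].
  rewrite ler_wpM2l ?mangoldt_ge0 // ler_pdivlMr ?ltr0n // -natrM ler_nat; exact: leq_trunc_div.
have lo : N%:R * S <= sum_ln R N + chebyshev_psi R N.
  rewrite e ES -big_split /=; apply: ler_sum_nat => d /andP[d0 _].
  rewrite -[X in _ <= _ + X]mulr1 -mulrDr ler_wpM2l ?mangoldt_ge0 //.
  rewrite ler_pdivrMr ?ltr0n // natr1 -natrM ler_nat.
  by rewrite ltnW // ltn_ceil.
have l := le_ln_id n0.
rewrite -(ler_pM2l n0) -{1}(gtr0_norm n0) -normrM ler_norml mulrBr.
have n1 : (1 : R) <= N%:R by rewrite ler1n.
by apply/andP; split; lra.
Qed.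

(** Here g is Euler's constant. The numbers H_N - ln(N + 1) increase and the numbers H_N - ln N
    decrease; g, the supremum of the former, lies between them, and they are at most 1/N apart. *)
Lemma harmonic_ln (R : realType) : exists g : R,
  forall N, (0 < N)%N -> `|\sum_(1 <= m < N.+1) m%:R^-1 - ln N%:R - g| <= N%:R^-1.
Proof.
pose h N : R := \sum_(1 <= m < N.+1) m%:R^-1.
have hS N : h N.+1 = h N + N.+1%:R^-1 by rewrite /h big_nat_recr.
have step N : (0 < N)%N ->
  N.+1%:R^-1 <= (ln N.+1%:R - ln N%:R : R) <= N%:R^-1.
  move=> N0; have n0 : (0 : R) < N%:R by rewrite ltr0n.
  have n1 : (0 : R) < N.+1%:R by rewrite ltr0n.
  have := ln_sub_le n0 n1; have := ln_sub_le n1 n0.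
  have -> : N%:R - N.+1%:R = -1 :> R by rewrite -natr1; ring.
  have -> : N.+1%:R - N%:R = 1 :> R by rewrite -natr1; ring.
  by rewrite mulN1r mul1r => h1 h2; rewrite h2 andbT -lerN2 opprB.
have dec M N : (0 < M)%N -> (M <= N)%N -> h N - ln N%:R <= h M - ln M%:R.
  move=> M0; elim: N => [|N IH]; first by case: M M0.
  rewrite leq_eqVlt => /orP[/eqP -> //|]; rewrite ltnS => MN.
  have /andP[s _] := step N (leq_trans M0 MN); have := IH MN; rewrite hS.
  by move: (N.+1%:R^-1) s => a s; lra.
have inc M N : (0 < M)%N -> (M <= N)%N -> h M - ln M.+1%:R <= h N - ln N.+1%:R.
  move=> M0; elim: N => [|N IH]; first by case: M M0.
  rewrite leq_eqVlt => /orP[/eqP -> //|]; rewrite ltnS => MN.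
  have /andP[_ s] := step N.+1 isT; have := IH MN; rewrite hS.
  by move: (N.+1%:R^-1) s => a s; lra.
pose A := [set h N - ln N.+1%:R | N in [set N : nat | (0 < N)%N]]%classic.
have cross M N : (0 < M)%N -> (0 < N)%N -> h N - ln N.+1%:R <= h M - ln M%:R.
  move=> M0 N0; have s n : (0 < n)%N -> ln n%:R <= ln n.+1%:R :> R.
    by move=> n0; rewrite ler_ln ?posrE ?ltr0n // ler_nat.
  have [MN|/ltnW NM] := leqP M N.
    by have := dec _ _ M0 MN; have := s _ N0; lra.
  by have := inc _ _ N0 NM; have := s _ M0; lra.
have ubA M : (0 < M)%N -> ubound A (h M - ln M%:R).
  by move=> M0 _ [N N0 <-]; exact: cross.
have supA : has_sup A.
  by split; [exists (h 1%N - ln 2), 1%N | exists (h 1%N - ln 1); exact: ubA].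
exists (sup A) => N N0; rewrite -/(h N).
have g1 : h N - ln N.+1%:R <= sup A by apply: ub_le_sup; [case: supA | exists N].
have g2 : sup A <= h N - ln N%:R by apply: ge_sup; [case: supA | exact: ubA].
have /andP[_ s] := step N N0; move: (N%:R^-1) s => a s.
by rewrite ger0_norm; lra.
Qed.

Lemma sum_sqrt_div (R : realType) (N : nat) :
  \sum_(1 <= n < N.+1) Num.sqrt (N%:R / n%:R) <= 2 * N%:R :> R.
Proof.
have H M : \sum_(1 <= n < M.+1) (Num.sqrt n%:R)^-1 <= 2 * Num.sqrt M%:R :> R.
  elim: M => [|M IH]; first by rewrite big_geq // mulr_ge0 ?sqrtr_ge0.
  rewrite big_nat_recr //=; apply: le_trans (lerD IH (lexx _)) _.
  set a : R := Num.sqrt M%:R; set b : R := Num.sqrt M.+1%:R.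
  have b0 : 0 < b by rewrite sqrtr_gt0 ltr0n.
  have a0 : 0 <= a by apply: sqrtr_ge0.
  have ab : b * b = a * a + 1 by rewrite -!expr2 !sqr_sqrtr ?ler0n // natr1.
  have le : a <= b by rewrite ler_sqrt ?ler_nat ?ltr0n.
  rewrite -(ler_pM2r b0) mulrDl mulVf ?gt_eqF //; nra.
under eq_bigr do rewrite sqrtrM ?ler0n // sqrtrV ?ler0n //.
rewrite -mulr_sumr; apply: le_trans (ler_wpM2l (sqrtr_ge0 _) (H N)) _.
by rewrite mulrCA -expr2 sqr_sqrtr ?ler0n.
Qed.

(** With u = t^4 and ln t <= t, the left side is at most (1 + 4 t)^2 <= 25 t^2. *)
Lemma sqr_ln_le_sqrt (R : realType) (u : R) : 1 <= u -> (1 + ln u) ^+ 2 <= 25 * Num.sqrt u.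
Proof.
move=> u1; set s := Num.sqrt u.
have u0 : 0 <= u by lra.
have s1 : 1 <= s by rewrite -[leLHS]sqrtr1 ler_sqrt //; lra.
set t := Num.sqrt s.
have t1 : 1 <= t by rewrite -[leLHS]sqrtr1 ler_sqrt //; lra.
have Es : t ^+ 2 = s by rewrite sqr_sqrtr //; lra.
have Eu : t ^+ 4 = u by rewrite (exprM t 2 2) Es sqr_sqrtr.
have t0 : 0 < t by lra.
have lt := le_ln_id t0.
have lu : ln u = 4 * ln t by rewrite -Eu lnXn // mulr_natl.
have l0 : 0 <= ln t by rewrite ln_ge0.
by rewrite -Es lu; nra.
Qed.

(** A Moebius inversion twisted by a logarithm is applied to F(r) = psi(N/r) - N/r + c. The sums of
    F over multiples grow only logarithmically, so the total is O(N); Mertens' estimate then turns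
    the terms in N/r into - 2 N ln N up to O(N). *)
Lemma selberg_nat (R : realType) : exists2 K : R, 0 <= K & forall N, (0 < N)%N ->
  `|chebyshev_psi R N * ln N%:R
    + \sum_(1 <= r < N.+1) mangoldt R r * chebyshev_psi R (N %/ r)
    - 2 * N%:R * ln N%:R| <= K * N%:R.
Proof.
have [g Hg] := harmonic_ln R; have [K0 K00 HK0] := mertens R.
(* With u = N/n and M = floor(u), the sum of the F(n m) is (M ln M - M) - u (ln M + g) + c M up to
   O(1 + ln u); this c cancels the linear terms. *)
pose c := g + 1; pose C := 3 + `|g|.
have C0 : 0 <= C by rewrite addr_ge0.
exists (50 * C + `|c| + K0 + 20 * `|c|); first by rewrite !addr_ge0 ?mulr_ge0 //.
move=> N N0; have n0 : (0 : R) < N%:R by rewrite ltr0n.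
pose F r : R := chebyshev_psi R (N %/ r) - N%:R / r%:R + c.
have inner n : (0 < n <= N)%N ->
    `|\sum_(1 <= m < (N %/ n).+1) F (n * m)%N| <= C * (1 + ln (N%:R / n%:R)).
  move=> /andP[n1 nN]; set M := (N %/ n)%N; set u : R := N%:R / n%:R.
  have rn : (0 : R) < n%:R by rewrite ltr0n.
  have M0 : (0 < M)%N by rewrite divn_gt0.
  have rM : (1 : R) <= M%:R by rewrite ler1n.
  have Mu : M%:R <= u by rewrite ler_pdivlMr // -natrM ler_nat leq_trunc_div.
  have uM : u <= M%:R + 1 by rewrite ler_pdivrMr // natr1 -natrM ler_nat ltnW // ltn_ceil.
  have -> : \sum_(1 <= m < M.+1) F (n * m)%N =
      sum_ln R M - u * \sum_(1 <= m < M.+1) m%:R^-1 + c * M%:R.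
    have -> : c * M%:R = \sum_(1 <= m < M.+1) c by rewrite sumr_const_nat subn1 mulr_natr.
    rewrite -sum_chebyshev_psi mulr_sumr -sumrB -big_split /=.
    apply: eq_big_nat => m /andP[m0 _].
    by rewrite /F divnMA natrM invfM mulrA.
  have := Hg M M0; set H := \sum_(1 <= m < M.+1) _ => hH.
  have /andP[T1 T2] := sum_ln_bounds R M0.
  have lM : 0 <= ln M%:R :> R by rewrite ln_ge0.
  have lMu : ln M%:R <= ln u by rewrite ler_ln ?posrE //; lra.
  have uH : `|u * (H - ln M%:R - g)| <= 2.
    rewrite normrM ger0_norm; last by lra.
    apply: le_trans (ler_wpM2l _ hH) _; first by lra.
    by rewrite ler_pdivrMr; lra.
  have gM : `|g * (M%:R - u)| <= `|g|.
    by rewrite normrM ler_piMr // ler_norml; lra.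
  have uMl : 0 <= (u - M%:R) * ln M%:R <= ln M%:R.
    by rewrite mulr_ge0 ?ler_piMl //; lra.
  have -> : sum_ln R M - u * H + c * M%:R =
     (sum_ln R M - (M%:R * ln M%:R - M%:R)) - (u - M%:R) * ln M%:R
     - u * (H - ln M%:R - g) + g * (M%:R - u) by rewrite /c; ring.
  move: uH gM uMl; rewrite !ler_norml => /andP[a1 a2] /andP[b1 b2] /andP[c1 c2].
  have := normr_ge0 g; have : 0 <= `|g| * ln u by rewrite mulr_ge0 //; lra.
  by rewrite /C; lra.
(* The Tatuzawa-Iseki identity: the sum of mu(d) ln(N/d) over the divisors d of r is Lambda(r), plus
   ln N when r = 1. *)
have key : F 1%N * ln N%:R + \sum_(1 <= r < N.+1) mangoldt R r * F r =
    \sum_(1 <= n < N.+1) (mobius R n * ln (N%:R / n%:R)) *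
       \sum_(1 <= m < (N %/ n).+1) F (n * m)%N.
  rewrite exchange_sum_multiples.
  transitivity (\sum_(1 <= r < N.+1) (F r * ((r == 1%N)%:R * ln N%:R) + F r * mangoldt R r)).
    rewrite big_split /=; congr (_ + _); last by apply: eq_bigr => r _; rewrite mulrC.
    rewrite big_ltn // big1_seq ?addr0 ?mul1r //.
    move=> r; rewrite mem_index_iota => /andP[_ /andP[r1 _]].
    by rewrite gtn_eqF // mul0r mulr0.
  apply: eq_big_nat => r /andP[r0 _]; rewrite -mulrDr; congr (_ * _).
  rewrite -sum_mobius // -[mangoldt R r]opprK -sum_mobius_ln // mulr_suml -sumrB.
  apply: eq_big_seq => d; rewrite -dvdn_divisors // => dr.
  have d0 := dvdn_gt0 r0 dr.
  by rewrite ln_div ?posrE ?ltr0n // mulrBr.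
have bound : `|F 1%N * ln N%:R + \sum_(1 <= r < N.+1) mangoldt R r * F r| <= 50 * C * N%:R.
  rewrite key; apply: le_trans (ler_norm_sum _ _ _) _.
  (* For u = N/n one has ln u (1 + ln u) <= 25 sqrt u, and the sqrt(N/n) add up to at most 2 N. *)
  apply: le_trans (_ : \sum_(1 <= n < N.+1) (25 * C) * Num.sqrt (N%:R / n%:R) <= _).
    apply: ler_sum_nat => n /andP[n1]; rewrite ltnS => nN.
    have u1 : 1 <= N%:R / n%:R :> R by rewrite ler_pdivlMr ?ltr0n // mul1r ler_nat.
    have lu : 0 <= ln (N%:R / n%:R) :> R by rewrite ln_ge0.
    have inn := inner n; rewrite n1 nN in inn.
    rewrite !normrM (ger0_norm lu).
    apply: le_trans (_ : 1 * ln (N%:R / n%:R) * (C * (1 + ln (N%:R / n%:R))) <= _).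
      apply: ler_pM; rewrite ?mulr_ge0 ?inn //.
      by rewrite ler_wpM2r // norm_mobius_le1.
    have := sqr_ln_le_sqrt u1; set L := ln _ in lu *; set s := Num.sqrt _ => h.
    have : L * (1 + L) <= 25 * s by nra.
    by move=> /(ler_wpM2l C0); lra.
  rewrite -mulr_sumr; have := sum_sqrt_div R N.
  have C25 : 0 <= 25 * C by lra.
  by move=> /(ler_wpM2l C25); lra.
have ES : \sum_(1 <= r < N.+1) mangoldt R r * F r =
    \sum_(1 <= r < N.+1) mangoldt R r * chebyshev_psi R (N %/ r)
    - N%:R * \sum_(1 <= r < N.+1) mangoldt R r / r%:R + c * chebyshev_psi R N.
  rewrite !mulr_sumr -sumrB -big_split /=; apply: eq_bigr => r _; rewrite /F; ring.
have F1 : F 1%N = chebyshev_psi R N - N%:R + c by rewrite /F divn1 divr1.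
rewrite ES F1 in bound; have := HK0 N N0.
set S1 := \sum_(1 <= r < N.+1) _ * _ in bound *; set S2 := \sum_(1 <= r < N.+1) _ / _ in bound *.
move=> HM; have ps := chebyshev_psi_le R N; have ps0 := chebyshev_psi_ge0 R N.
have lN := le_ln_id n0; have lN0 : 0 <= ln N%:R :> R by rewrite ln_ge0 // ler1n.
set P := chebyshev_psi R N in bound ps ps0 *; set L := ln N%:R in bound lN lN0 HM *.
have e1 : `|c * L| <= `|c| * N%:R by rewrite normrM ler_wpM2l // ger0_norm.
have e2 : `|c * P| <= `|c| * (20 * N%:R) by rewrite normrM ler_wpM2l // ger0_norm.
have e3 : `|N%:R * (S2 - L)| <= N%:R * K0 by rewrite normrM gtr0_norm // ler_pM2l.
move: e1 e2 e3 bound; rewrite !ler_norml => /andP[a1 a2] /andP[b1 b2] /andP[c1 c2] /andP[d1 d2].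
lra.
Qed.

(** * Primes in short intervals *)

Definition psi (R : realType) (x : R) : R := chebyshev_psi R (Num.truncn x).

Definition mangoldt_mass (R : realType) (N : nat) : R :=
  \sum_(1 <= n < N.+1) mangoldt R n / n%:R.

Lemma psi_ge0 (R : realType) (x : R) : 0 <= psi x.
Proof. exact: chebyshev_psi_ge0. Qed.

Lemma le_psi (R : realType) (x y : R) : x <= y -> psi x <= psi y.
Proof. by move=> xy; apply: le_chebyshev_psi; apply: le_truncn. Qed.

Lemma psi_le (R : realType) (x : R) : 0 <= x -> psi x <= 20 * x.
Proof.
move=> x0; apply: le_trans (chebyshev_psi_le R _) _.
by rewrite ler_pM2l ?truncn_le.
Qed.

Lemma truncn_div_nat (R : realType) (x : R) (n : nat) :
  0 <= x -> (0 < n)%N -> Num.truncn (x / n%:R) = (Num.truncn x %/ n)%N.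
Proof.
move=> x0 n0; have rn : (0 : R) < n%:R by rewrite ltr0n.
have /andP[h1 h2] := truncn_itv x0.
apply: truncn_def; apply/andP; split.
  rewrite ler_pdivlMr //; apply: le_trans h1; rewrite -natrM ler_nat; exact: leq_trunc_div.
rewrite ltr_pdivrMr //; apply: lt_le_trans h2 _; rewrite -natrM ler_nat; exact: ltn_ceil.
Qed.

Lemma truncn_near (R : realType) (x : R) : 1 <= x ->
  [/\ (0 < Num.truncn x)%N, (1 : R) <= (Num.truncn x)%:R,
      (Num.truncn x)%:R <= x & x <= (Num.truncn x)%:R + 1].
Proof.
move=> x1; have x0 : 0 <= x by lra.
have h : (0 < Num.truncn x)%N by rewrite truncn_gt0.
have /andP[h1 h2] := truncn_itv x0.
by split=> //; [rewrite ler1n | rewrite natr1 ltW].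
Qed.

Lemma le_ln_of (R : realType) (x y : R) : 0 < x -> x <= y -> ln x <= ln y.
Proof. by move=> x0 xy; rewrite ler_ln ?posrE //; lra. Qed.

(** The upper limit N is free because psi(x/n) = 0 once n > x; the formulas at two points can then
    be subtracted over a common range. *)
Lemma selberg_real (R : realType) : exists2 K : R, 0 <= K & forall (x : R) (N : nat),
  1 <= x -> (Num.truncn x <= N)%N ->
  `|psi x * ln x + \sum_(1 <= n < N.+1) mangoldt R n * psi (x / n%:R)
    - 2 * x * ln x| <= K * x.
Proof.
have [K K0 HK] := selberg_nat R; exists (K + 24); first by lra.
move=> x N x1 xN; have [t0 t1 tx xt] := truncn_near x1.
have -> : \sum_(1 <= n < N.+1) mangoldt R n * psi (x / n%:R) =
    \sum_(1 <= n < (Num.truncn x).+1) mangoldt R n * chebyshev_psi R (Num.truncn x %/ n).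
  rewrite (@big_cat_nat _ _ _ (Num.truncn x).+1 1 N.+1) //= [X in _ + X]big1_seq ?addr0.
    by apply: eq_big_nat => n /andP[n0 _]; rewrite /psi truncn_div_nat //; lra.
  move=> n; rewrite mem_index_iota => /andP[_ /andP[n1 _]].
  rewrite /psi truncn_div_nat ?divn_small //; [|lra|lia].
  by rewrite /chebyshev_psi big_geq // mulr0.
have := HK _ t0; rewrite /psi; have := chebyshev_psi_le R (Num.truncn x).
have := chebyshev_psi_ge0 R (Num.truncn x).
set P := chebyshev_psi R _; set S := \sum_(1 <= n < _) _; set t : R := (Num.truncn x)%:R in t1 tx xt *.
move=> P0 P20; have x0 : 0 < x by lra.
have tp : 0 < t by lra.
have d1 := ln_sub_le tp x0; rewrite ler_pdivlMr // in d1.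
have d0 := le_ln_of tp tx; have lx := le_ln_id x0; have lt0 : 0 <= ln t by rewrite ln_ge0.
have e1 : 0 <= P * (ln x - ln t) <= 20.
  rewrite mulr_ge0 ?subr_ge0 //=.
  apply: le_trans (_ : 20 * t * (ln x - ln t) <= _); last by lra.
  by rewrite ler_wpM2r // subr_ge0.
have e2 : 0 <= (x - t) * ln x <= x.
  rewrite mulr_ge0 ?subr_ge0 //=; last lra.
  by apply: le_trans (_ : 1 * ln x <= _); [rewrite ler_wpM2r|]; lra.
have Kt : K * t <= K * x by rewrite ler_wpM2l.
have e3 : 0 <= t * (ln x - ln t) by rewrite mulr_ge0 ?subr_ge0 // ltW.
rewrite !ler_norml => /andP[h1 h2].
move: e1 e2 => /andP[a1 a2] /andP[b1 b2].
by apply/andP; split; lra.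
Qed.

Lemma mertens_real (R : realType) : exists2 K : R, 0 <= K & forall x : R,
  1 <= x -> `|mangoldt_mass R (Num.truncn x) - ln x| <= K.
Proof.
have [K K0 HK] := mertens R; exists (K + 1); first by lra.
move=> x x1; have [t0 t1 tx xt] := truncn_near x1.
have := HK _ t0; rewrite -/(mangoldt_mass R _).
set t : R := (Num.truncn x)%:R in t1 tx xt *.
have tp : 0 < t by lra.
have x0 : 0 < x by lra.
have d1 := ln_sub_le tp x0; have d0 := le_ln_of tp tx.
have : (x - t) / t <= 1 by rewrite ler_pdivrMr //; lra.
by rewrite !ler_norml => h /andP[h1 h2]; apply/andP; split; lra.
Qed.

(** The formulas of [selberg_real] at x and y are subtracted; since x <= M y, replacing ln x by ln y
    costs only O(y). *)
Lemma selberg_interval (R : realType) (M : R) : 1 <= M ->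
  exists2 K : R, 0 <= K & forall (y x : R) (N : nat),
  1 <= y -> y <= x -> x <= M * y -> (Num.truncn x <= N)%N ->
  `|(psi x - psi y) * ln y
    + \sum_(1 <= n < N.+1) mangoldt R n * (psi (x / n%:R) - psi (y / n%:R))
    - 2 * (x - y) * ln y| <= K * y.
Proof.
move=> M1; have [K K0 HK] := selberg_real R.
have lM : 0 <= ln M by rewrite ln_ge0.
have Ml : 0 <= M * ln M by rewrite mulr_ge0 //; lra.
exists (K * M + K + 20 * (M * ln M)); first by rewrite !addr_ge0 ?mulr_ge0 //; lra.
move=> y x N y1 yx xM xN.
have h1 := HK x N ltac:(lra) xN.
have h2 := HK y N y1 (leq_trans (le_truncn yx) xN).
under eq_bigr do rewrite mulrBr.
rewrite sumrB; move: h1 h2.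
set S1 := \sum_(1 <= n < _) _; set S2 := \sum_(1 <= n < _) _.
have y0 : 0 < y by lra.
have x0 : 0 < x by lra.
have lyx := le_ln_of y0 yx.
have lxM : ln x <= ln M + ln y by rewrite -lnM ?posrE ?le_ln_of //; lra.
have px := psi_le (ltW x0); have p0 := psi_ge0 x.
have e0 : 0 <= x * (ln x - ln y) <= M * ln M * y.
  rewrite mulr_ge0 ?subr_ge0 //=; last lra.
  apply: le_trans (_ : M * y * ln M <= _); last by lra.
  by apply: ler_pM; lra.
have e1 : 0 <= psi x * (ln x - ln y) <= 20 * (x * (ln x - ln y)).
  by rewrite mulr_ge0 ?subr_ge0 //= mulrA ler_wpM2r // subr_ge0.
have KM : K * x <= K * M * y by rewrite -mulrA ler_wpM2l.
move: e0 e1 => /andP[a1 a2] /andP[b1 b2].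
rewrite !ler_norml => /andP[c1 c2] /andP[d1 d2].
by apply/andP; split; lra.
Qed.

(** The sum over n in [selberg_interval] is nonnegative, so division by ln y gives the density 2,
    with an error K / ln y that drops below eps. *)
Lemma psi_interval_le (R : realType) (M eps : R) : 1 <= M -> 0 < eps ->
  exists2 Y : R, 1 <= Y & forall y x : R, Y <= y -> y <= x -> x <= M * y ->
  psi x - psi y <= 2 * (x - y) + eps * y.
Proof.
move=> M1 e0; have [K K0 HK] := selberg_interval M1.
exists (expR (K / eps) + 1); first by rewrite lerDr expR_ge0.
move=> y x Yy yx xM; have ex0 := expR_gt0 (K / eps).
have y1 : 1 <= y by lra.
have := HK y x _ y1 yx xM (leqnn _).
set S := \sum_(1 <= n < _) _; have S0 : 0 <= S.
  apply: sumr_ge0 => n _; rewrite mulr_ge0 ?mangoldt_ge0 // subr_ge0 le_psi //.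
  by rewrite ler_wpM2r ?invr_ge0.
have ly : K / eps < ln y.
  by rewrite -(expRK (K / eps)) ltr_ln ?posrE //; lra.
have ly0 : 0 < ln y by apply: le_lt_trans ly; rewrite divr_ge0 // ltW.
rewrite ltr_pdivrMr // in ly.
rewrite ler_norml => /andP[_ h].
rewrite -(ler_pM2r ly0).
have : K * y <= ln y * eps * y by rewrite ler_wpM2r //; lra.
by lra.
Qed.

(** A gap in the limit only: the mass of (x, lam x] is o(x) along some sequence of x tending to
    infinity, but need not vanish. *)
Definition prime_gap (R : realType) (lam : R) : Prop :=
  forall del Y : R, 0 < del -> exists2 x, Y <= x & psi (lam * x) - psi x < del * x.

(* By [psi_interval_le], 2 is the largest possible density of primes. *)
Definition dense_primes (R : realType) (lam M : R) : Prop :=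
  forall eps Y : R, 0 < eps -> exists y x, [/\ Y <= y, lam * y <= x, x <= M * y &
    2 * (x - y) - eps * y <= psi x - psi y].

(** Without a gap every interval (y/n, lam y/n] with y/n >= Y has mass at least del y/n, so by
    Mertens the sum in Selberg's formula is at least about del y ln y. This much is lost for the
    mass of (y, x], which contradicts density 2. *)
Lemma dense_primes_gap (R : realType) (lam M : R) :
  1 <= lam -> 1 <= M -> dense_primes lam M -> prime_gap lam.
Proof.
move=> l1 M1 dense del Y0 d0; apply: contrapT => ngap.
pose Y := Order.max Y0 1.
have Y1 : 1 <= Y by rewrite le_max lexx orbT.
have H x : Y <= x -> del * x <= psi (lam * x) - psi x.
  rewrite ge_max => /andP[Yx _]; rewrite leNgt; apply/negP => lt.
  by apply: ngap; exists x.
have [K K0 HK] := selberg_interval M1; have [K' K'0 HK'] := mertens_real R.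
have d2 : 0 < del / 2 by lra.
(* Beyond exp L the term (del / 2) ln y exceeds all the bounded ones. *)
pose L := (K + del * (ln Y + K')) / (del / 2).
have eL := expR_gt0 L.
have [y [x [Yy lx xM D]]] := dense _ (Order.max Y (expR L + 1)) d2.
move: Yy; rewrite ge_max => /andP[Yy Ly].
have y0 : 0 < y by lra.
have yx : y <= x by apply: le_trans lx; rewrite ler_peMl //; lra.
have lY : L < ln y by rewrite -(expRK L) ltr_ln ?posrE //; lra.
rewrite ltr_pdivrMr // in lY.
have ly0 : 0 <= ln y by rewrite ln_ge0 //; lra.
have := HK y x _ ltac:(lra) yx xM (leqnn _).
set S := \sum_(1 <= n < _) _.
have yY1 : 1 <= y / Y by rewrite ler_pdivlMr; lra.
have yYx : y / Y <= x by rewrite ler_pdivrMr; nra.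
have SM : del * y * mangoldt_mass R (Num.truncn (y / Y)) <= S.
  rewrite /S (@big_cat_nat _ _ _ (Num.truncn (y / Y)).+1) //=; last by rewrite ltnS le_truncn.
  rewrite -[leLHS]addr0 lerD //; last first.
    apply: sumr_ge0 => n _; rewrite mulr_ge0 ?mangoldt_ge0 // subr_ge0 le_psi //.
    by rewrite ler_wpM2r ?invr_ge0.
  rewrite mulr_sumr; apply: ler_sum_nat => n /andP[n0]; rewrite ltnS => nt.
  rewrite mulrCA ler_wpM2l ?mangoldt_ge0 //.
  have rn : (0 : R) < n%:R by rewrite ltr0n.
  have Yn : Y <= y / n%:R.
    rewrite ler_pdivlMr // mulrC -ler_pdivlMr; last by lra.
    by apply: le_trans (_ : (Num.truncn (y / Y))%:R <= _); [rewrite ler_nat | rewrite truncn_le; lra].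
  rewrite -mulrA; apply: le_trans (H _ Yn) _.
  by rewrite lerD2r le_psi // mulrA ler_wpM2r ?invr_ge0 // ltW.
have := HK' _ yY1; rewrite ln_div ?posrE //; last lra.
set m := mangoldt_mass _ _ in SM *.
rewrite !ler_norml => /andP[m1 m2] /andP[_ h].
have t1 : del * y * (ln y - ln Y - K') <= del * y * m.
  by rewrite ler_wpM2l ?mulr_ge0 //; lra.
have t2 := ler_wpM2r ly0 D.
have t3 : y * (K + del * (ln Y + K')) < y * (ln y * (del / 2)) by rewrite ltr_pM2l.
by lra.
Qed.

(** With w = N / (1 + s), psi grows by at most 4 s w on (w, N], and each n there has 1/n <= 1/w. *)
Lemma mass_short (R : realType) (s Y : R) (N : nat) : 0 < s -> 1 <= Y ->
  (forall y x, Y <= y -> y <= x -> x <= (1 + s) * y ->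
     psi x - psi y <= 2 * (x - y) + 2 * s * y) ->
  (1 + s) * Y <= N%:R ->
  \sum_((Num.truncn (N%:R / (1 + s) : R)).+1 <= n < N.+1) mangoldt R n / n%:R <= 4 * s.
Proof.
move=> s0 Y1 HY YN; have s1 : 0 < 1 + s by lra.
have Np : (0 : R) < N%:R by apply: lt_le_trans YN; rewrite mulr_gt0 //; lra.
set w : R := N%:R / (1 + s); have q : N%:R = w * (1 + s) by rewrite divfK // gt_eqF.
have w0 : 0 < w by rewrite divr_gt0.
have wN : w <= N%:R by rewrite q mulrDr mulr1 lerDl mulr_ge0 // ltW.
have tN : (Num.truncn w <= N)%N by rewrite -[leqRHS](@natrK R); apply: le_truncn.
have h : psi N%:R - psi w <= 4 * s * w.
  apply: le_trans (HY w N%:R _ wN _) _.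
  - by rewrite ler_pdivlMr // mulrC.
  - by rewrite mulrC -q.
  - by rewrite [X in X - w]q; lra.
apply: le_trans (_ : (1 + s) / N%:R * (psi N%:R - psi w) <= _); last first.
  apply: le_trans (ler_wpM2l _ h) _; first by rewrite divr_ge0 // ltW.
  have -> : (1 + s) / N%:R * (4 * s * w) = 4 * s * (((1 + s) / N%:R) * N%:R / (1 + s)).
    by rewrite mulrCA /w !mulrA.
  by rewrite divfK ?divff ?mulr1 // gt_eqF.
rewrite /psi natrK /chebyshev_psi (@big_cat_nat _ _ _ (Num.truncn w).+1 1 N.+1) //=.
rewrite addrAC subrr add0r mulr_sumr.
apply: ler_sum_nat => n /andP[n1 n2].
have rn : (0 : R) < n%:R by rewrite ltr0n (leq_ltn_trans _ n1).
have wn : w <= n%:R by rewrite ltW // -truncn_lt_nat // ltW.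
rewrite mulrC ler_wpM2r ?mangoldt_ge0 //.
by rewrite -[leLHS]mul1r ler_pdivrMr // mulrAC ler_pdivlMr // mul1r mulrC q ler_pM2r.
Qed.

(** The members of g form clusters of ratio below 1 + s, s = ln lam / 8, and distinct clusters are
    more than a factor lam apart. A cluster has mass at most 4 s = ln lam / 2, half of what an
    interval of ratio lam carries on average. *)
Lemma sparse_mass_le (R : realType) (lam : R) : 1 < lam ->
  exists2 K : R, 0 <= K & forall g : pred nat,
  (forall n n', g n -> g n' -> (n < n')%N -> n'%:R <= lam * n%:R ->
     n'%:R < (1 + ln lam / 8) * n%:R) ->
  forall N, (0 < N)%N ->
  \sum_(1 <= n < N.+1 | g n) mangoldt R n / n%:R <= ln N%:R / 2 + K.
Proof.
move=> l1; have ll0 : 0 < ln lam by rewrite ln_gt0.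
have ll1 : ln lam <= lam - 1.
  have l0 : 0 < lam by lra.
  by have := ln_sub_le ltr01 l0; rewrite ln1 divr1; lra.
set s := ln lam / 8; have s0 : 0 < s by rewrite /s; lra.
have sl : 1 + s <= lam by rewrite /s; lra.
have sE : ln lam = 8 * s by rewrite /s; lra.
have [Y Y1 HY] := @psi_interval_le R (1 + s) (2 * s) ltac:(lra) ltac:(lra).
have [K K0 HK] := mertens_real R.
pose Z := (1 + s) * Y + lam + 2.
have sY : 0 < (1 + s) * Y by rewrite mulr_gt0; lra.
have lZ : 0 <= ln Z by rewrite ln_ge0 // /Z; lra.
exists (ln Z + K); first by lra.
move=> g Hg; elim/ltn_ind => N IH N0.
have rN : (1 : R) <= N%:R by rewrite ler1n.
have lN : 0 <= ln N%:R :> R by rewrite ln_ge0.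
have [NZ|ZN] := ltP N%:R Z.
  apply: le_trans (_ : mangoldt_mass R N <= _).
    rewrite /mangoldt_mass [leRHS](bigID g) /= lerDl.
    by apply: sumr_ge0 => n _; rewrite divr_ge0 ?mangoldt_ge0.
  have := HK _ rN; rewrite natrK ler_norml => /andP[_ h].
  have : ln N%:R <= ln Z by apply: le_ln_of; lra.
  by lra.
have N2 : (1 < N)%N by rewrite -(ltr_nat R); rewrite /Z in ZN; lra.
have [gN|ngN] := boolP (g N); last first.
  case: N N2 IH ngN {N0 rN ZN} lN => // N N2 IH ngN lN.
  rewrite big_mkcond big_nat_recr //= (negPf ngN) addr0 -big_mkcond /=.
  apply: le_trans (IH N (leqnn _) N2) _.
  by rewrite lerD2r ler_pM2r ?invr_gt0 // le_ln_of ?ltr0n ?ler_nat.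
(* As N is in g, the other members beyond N / lam lie beyond N / (1 + s). Together they weigh at
   most 4 s, which is exactly what the induction at N / lam saves. *)
pose N1 := Num.truncn (N%:R / lam); pose N2' := Num.truncn (N%:R / (1 + s)).
have Np : (0 : R) < N%:R by lra.
have Nl1 : 1 <= N%:R / lam by rewrite ler_pdivlMr; rewrite /Z in ZN; lra.
have Nls : N%:R / lam <= N%:R / (1 + s) by rewrite ler_pM2l // lef_pV2 ?posrE; lra.
have NsN : N%:R / (1 + s) <= N%:R by rewrite ler_pdivrMr; nra.
have [t0 t1 tx xt] := truncn_near Nl1.
have N1N2 : (N1 <= N2')%N by apply: le_truncn.
have N2N : (N2' <= N)%N by rewrite -[leqRHS](@natrK R); apply: le_truncn.
have N1N : (N1 < N)%N.
  rewrite /N1 truncn_lt_nat; last by lra.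
  by rewrite ltr_pdivrMr; nra.
have S1 := IH N1 N1N t0.
have lN1 : ln N1%:R <= ln N%:R - ln lam.
  rewrite -ln_div ?posrE //; last lra.
  by apply: le_ln_of => //; lra.
rewrite (@big_cat_nat _ _ _ N1.+1 1 N.+1) //=; last exact: leqW.
have S2 : \sum_(N1.+1 <= n < N.+1 | g n) mangoldt R n / n%:R <= 4 * s.
  rewrite (@big_cat_nat _ _ _ N2'.+1 N1.+1 N.+1) //=.
  rewrite big1_seq ?add0r; last first.
    move=> n; rewrite mem_index_iota => /andP[gn /andP[n1]]; rewrite ltnS => n2; exfalso.
    have nN : (n < N)%N.
      apply: leq_ltn_trans n2 _; rewrite /N2' truncn_lt_nat; last by lra.
      by rewrite ltr_pdivrMr; nra.
    have n2' : n%:R <= N%:R / (1 + s).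
      by apply: le_trans (_ : N2'%:R <= _); rewrite ?ler_nat // truncn_le; lra.
    have n1' : N%:R / lam < n%:R by rewrite -truncn_lt_nat //; lra.
    have := Hg n N gn gN nN; rewrite ltr_pdivrMr in n1'; last lra.
    by rewrite ler_pdivlMr in n2'; lra.
  have YN : (1 + s) * Y <= N%:R by rewrite /Z in ZN; lra.
  apply: le_trans (mass_short s0 Y1 HY YN).
  rewrite big_mkcond /=; apply: ler_sum => n _.
  by case: ifP => // _; rewrite divr_ge0 ?mangoldt_ge0.
by lra.
Qed.

(** With a = x/n and b = x/n', the overlap (a, lam b] has density at most 2 up to an error, so the
    union (b, lam a] of the two dense intervals is dense again. The errors e a, e b and e a are each
    at most e lam b. *)
Lemma dense_union (R : realType) (lam e : R) (x : R) (n n' : nat) (Y : R) :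
  1 < lam -> 0 < e -> 0 < x ->
  (forall y z, Y <= y -> y <= z -> z <= lam * y -> psi z - psi y <= 2 * (z - y) + e * y) ->
  (0 < n < n')%N -> n'%:R <= lam * n%:R -> Y <= x / n%:R ->
  (2 * (lam - 1) - e) * (x / n%:R) <= psi (lam * (x / n%:R)) - psi (x / n%:R) ->
  (2 * (lam - 1) - e) * (x / n'%:R) <= psi (lam * (x / n'%:R)) - psi (x / n'%:R) ->
  2 * (lam * (x / n%:R) - x / n'%:R) - 3 * lam * e * (x / n'%:R)
    <= psi (lam * (x / n%:R)) - psi (x / n'%:R).
Proof.
move=> l1 e0 x0 U /andP[n0 nn'] n'l Yn.
have rn : (0 : R) < n%:R by rewrite ltr0n.
have rn' : (0 : R) < n'%:R by rewrite ltr0n (ltn_trans n0).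
have ab : x / n'%:R <= x / n%:R.
  by rewrite ler_pM2l // lef_pV2 ?posrE // ler_nat ltnW.
have ba : x / n%:R <= lam * (x / n'%:R).
  rewrite mulrA [lam * x]mulrC -mulrA ler_pM2l // ler_pdivlMr // mulrC ler_pdivrMr //.
have b0 : 0 < x / n'%:R by rewrite divr_gt0.
move: (x / n%:R) (x / n'%:R) Yn ab ba b0 => a b Ya ab ba b0 ha hb.
have la : lam * b <= lam * a by rewrite ler_pM2l //; lra.
have u := U a (lam * b) Ya ba la.
have ea : e * a <= e * (lam * b) by rewrite ler_pM2l.
have eb : e * b <= e * (lam * b) by rewrite ler_pM2l // ler_peMl; lra.
by lra.
Qed.

(** At a gap the first term of Selberg's formula is negligible, so the sum over n comes near its
    maximum 2 (lam - 1) x ln x: for most n in the measure Lambda(n)/n the interval (x/n, lam x/n]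
    has nearly maximal density. If no longer interval were dense, [dense_union] would make these n
    sparse, and [sparse_mass_le] would leave them half of the measure. *)
Lemma prime_gap_dense (R : realType) (lam : R) : 1 < lam ->
  prime_gap lam -> dense_primes (lam * (1 + ln lam / 8)) (lam ^+ 2).
Proof.
move=> l1 gap eps Y eps0; apply: contrapT => ndense.
have D y x : Y <= y -> lam * (1 + ln lam / 8) * y <= x -> x <= lam ^+ 2 * y ->
    psi x - psi y < 2 * (x - y) - eps * y.
  by move=> *; rewrite ltNge; apply/negP => ?; apply: ndense; exists y, x.
have l0 : 0 < lam by lra.
have l1' : 1 <= lam by lra.
pose e := eps / (3 * lam).
have e0 : 0 < e by rewrite divr_gt0 // mulr_gt0.
have Ee : 3 * lam * e = eps by rewrite /e mulrC divfK // gt_eqF // mulr_gt0.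
have e8 : 0 < e / 8 by lra.
have [Y2 Y21 U] := psi_interval_le l1' e8.
have U' y z : Y2 <= y -> y <= z -> z <= lam * y -> psi z - psi y <= 2 * (z - y) + e * y.
  move=> h1 h2 h3; apply: le_trans (U y z h1 h2 h3) _; rewrite lerD2l ler_wpM2r //; lra.
pose Y1 := Order.max Y Y2.
have YY1 : Y <= Y1 by rewrite le_max lexx.
have YY2 : Y2 <= Y1 by rewrite le_max lexx orbT.
have Y11 : 1 <= Y1 by lra.
clearbody Y1 e.
have [K K0 HK] := selberg_interval l1'; have [K' K'0 HK'] := mertens_real R.
have [K3 K30 HK3] := sparse_mass_le l1.
have lY : 0 <= ln Y1 by rewrite ln_ge0.
have ll : 0 <= ln lam by rewrite ln_ge0.
(* Collects the bounded terms of the final comparison. *)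
pose C := 2 * (lam - 1) * K' + e * (ln Y1 + K') + (e + e / 8) * K3 + K
   + 20 * lam * (ln lam + ln Y1 + 2 * K').
(* The balance in units of e x ln x: counting all intervals as not good loses 1, the good ones give
   back at most half of 9/8, and the gap at most 1/8. The net loss 5/16 has to outweigh C. *)
pose X := Y1 + expR (16 * C / (5 * e)).
have [x Xx gx] := gap (e / 8) X e8.
have eX := expR_gt0 (16 * C / (5 * e)).
have xY : Y1 <= x by rewrite /X in Xx; lra.
have x0 : 0 < x by lra.
have lx0 : 0 <= ln x by rewrite ln_ge0 //; lra.
have lx : C < 5 * e / 16 * ln x.
  have : 16 * C / (5 * e) < ln x.
    by rewrite -(expRK (16 * C / (5 * e))) ltr_ln ?posrE //; rewrite /X in Xx; lra.
  by rewrite ltr_pdivrMr; [lra | rewrite mulr_gt0].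
clearbody X; clear Xx eX.
set N := Num.truncn (lam * x); set N' := Num.truncn (x / Y1).
have xl : x <= lam * x by rewrite ler_peMl //; lra.
have x1 : 1 <= x by lra.
have xY1 : 1 <= x / Y1 by rewrite ler_pdivlMr; lra.
have xYx : x / Y1 <= x by rewrite ler_pdivrMr ?ler_peMr //; lra.
have NN' : (N' <= N)%N by apply: le_truncn; lra.
have N'0 : (0 < N')%N by rewrite truncn_gt0.
have xY0 : 0 <= x / Y1 by lra.
pose a (n : nat) : R := x / n%:R.
have leY n : (0 < n <= N')%N -> Y1 <= a n.
  move=> /andP[n0 nN]; rewrite ler_pdivlMr ?ltr0n // mulrC -ler_pdivlMr; last by lra.
  by rewrite -truncn_ge_nat.
pose good n := [&& (0 < n)%N, (n <= N')%N &
  (2 * (lam - 1) - e) * a n <= psi (lam * a n) - psi (a n)].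
have G : \sum_(1 <= n < N'.+1 | good n) mangoldt R n / n%:R <= ln x / 2 + K3.
  apply: le_trans (HK3 good _ N' N'0) _; last first.
    rewrite lerD2r ler_pM2r ?invr_gt0 // le_ln_of ?ltr0n //.
    by apply: le_trans xYx; rewrite truncn_le.
  move=> n n' /and3P[n0 nN ha] /and3P[n0' nN' hb] nn' n'l; rewrite ltNge; apply/negP => far.
  have rn : (0 : R) < n%:R by rewrite ltr0n.
  have rn' : (0 : R) < n'%:R by rewrite ltr0n.
  have An : Y1 <= a n by apply: leY; rewrite n0.
  have Bn : Y1 <= a n' by apply: leY; rewrite n0'.
  have nn0 : (0 < n < n')%N by rewrite n0.
  have Ya : Y2 <= x / n%:R by apply: le_trans An.
  have du := dense_union l1 e0 x0 U' nn0 n'l Ya ha hb.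
  have h1 : Y <= x / n'%:R by apply: le_trans Bn.
  have h2 : lam * (1 + ln lam / 8) * (x / n'%:R) <= lam * (x / n%:R).
    rewrite -mulrA ler_pM2l // mulrA [_ * x]mulrC -mulrA ler_pM2l //.
    by rewrite ler_pdivrMr // ler_pdivlMl // [n%:R * _]mulrC.
  have h3 : lam * (x / n%:R) <= lam ^+ 2 * (x / n'%:R).
    rewrite expr2 -mulrA ler_pM2l // mulrA [_ * x]mulrC -mulrA ler_pM2l //.
    by rewrite ler_pdivlMr // ler_pdivrMl // [n%:R * _]mulrC.
  by rewrite Ee in du; have := lt_le_trans (D _ _ h1 h2 h3) du; rewrite ltxx.
have := HK x (lam * x) N x1 xl (lexx _) (leqnn _).
set S := \sum_(1 <= n < _) _; rewrite ler_norml => /andP[lowS _].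
have m1 := HK' _ xY1; rewrite ln_div ?posrE // -/N' in m1; last lra.
have m2 : `|mangoldt_mass R N - ln (lam * x)| <= K' by apply: HK'; lra.
rewrite lnM ?posrE // in m2.
(* Good n are bounded by [psi_interval_le], the others by their failure to be good. For n > N' only
   psi(x) <= 20 x is used, but these n have bounded mass by Mertens. *)
have upS : S <= x * ((2 * (lam - 1) - e) * mangoldt_mass R N' +
    (e + e / 8) * \sum_(1 <= n < N'.+1 | good n) mangoldt R n / n%:R +
    20 * lam * (mangoldt_mass R N - mangoldt_mass R N')).
  rewrite /S (@big_cat_nat _ _ _ N'.+1 1 N.+1) //= [leRHS]mulrDr; apply: lerD.
    rewrite [\sum_(1 <= n < _ | good n) _]big_mkcond /mangoldt_mass !mulr_sumr -big_split /= mulr_sumr.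
    apply: ler_sum_nat => n /andP[n0]; rewrite ltnS => nN.
    have An : Y1 <= a n by apply: leY; rewrite n0.
    have L := mangoldt_ge0 R n.
    have -> : lam * x / n%:R = lam * a n by rewrite mulrA.
    rewrite -/(a n); set t := psi _ - psi _.
    have [g|ng] := boolP (good n).
      have ht : t <= (2 * (lam - 1) - e) * a n + (e + e / 8) * a n.
        have an : a n <= lam * a n by rewrite ler_peMl //; lra.
        by have := U (a n) (lam * a n) ltac:(lra) an (lexx _); rewrite -/t; lra.
      apply: le_trans (ler_wpM2l L ht) _; rewrite /a le_eqVlt; apply/orP; left; apply/eqP; ring.
    have ht : t <= (2 * (lam - 1) - e) * a n.
      by move: ng; rewrite /good n0 nN /= -ltNge => /ltW.
    apply: le_trans (ler_wpM2l L ht) _; rewrite /a le_eqVlt; apply/orP; left; apply/eqP; ring.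
  rewrite /mangoldt_mass (@big_cat_nat _ _ _ N'.+1 1 N.+1) //= [_ + _ - _]addrAC subrr add0r.
  rewrite mulrA mulr_sumr; apply: ler_sum_nat => n /andP[n1 _].
  have rn : (0 : R) < n%:R by rewrite ltr0n (leq_ltn_trans _ n1).
  have L := mangoldt_ge0 R n.
  have lxn : 0 <= lam * x / n%:R by rewrite divr_ge0 ?mulr_ge0 // ltW.
  have ht : psi (lam * x / n%:R) - psi (x / n%:R) <= 20 * (lam * x / n%:R).
    by have := psi_le lxn; have := psi_ge0 (x / n%:R); lra.
  apply: le_trans (ler_wpM2l L ht) _; rewrite le_eqVlt; apply/orP; left; apply/eqP; ring.
move: m1 m2 G; set T := mangoldt_mass R N' in upS *; set T2 := mangoldt_mass R N in upS *.
set Gs := \sum_(1 <= n < N'.+1 | _) _ in upS *.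
rewrite !ler_norml => /andP[a1 a2] /andP[b1 b2] G.
have up2 : (2 * (lam - 1) - e) * T + (e + e / 8) * Gs + 20 * lam * (T2 - T)
   <= 2 * (lam - 1) * (ln x + K') - e * (ln x - ln Y1 - K')
      + (e + e / 8) * (ln x / 2 + K3) + 20 * lam * (ln lam + ln Y1 + 2 * K').
  have t1 : 2 * (lam - 1) * T <= 2 * (lam - 1) * (ln x + K').
    by apply: ler_wpM2l; lra.
  have t2 : e * (ln x - ln Y1 - K') <= e * T by rewrite ler_pM2l //; lra.
  have t3 : (e + e / 8) * Gs <= (e + e / 8) * (ln x / 2 + K3) by rewrite ler_pM2l //; lra.
  have t4 : 20 * lam * (T2 - T) <= 20 * lam * (ln lam + ln Y1 + 2 * K').
    by rewrite ler_pM2l ?mulr_gt0 //; lra.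
  by lra.
have gx2 : (psi (lam * x) - psi x) * ln x <= e / 8 * x * ln x by rewrite ler_wpM2r // ltW.
have {}up2 := ler_wpM2l (ltW x0) up2.
have lx' : x * C < x * (5 * e / 16 * ln x) by rewrite ltr_pM2l.
by rewrite /C in lx'; clear - lx' up2 upS lowS gx2; lra.
Qed.

Lemma prime_gap_le (R : realType) (lam mu : R) :
  lam <= mu -> prime_gap mu -> prime_gap lam.
Proof.
move=> lm gap del Y d0; have [x Yx gx] := gap del (Order.max Y 0) d0.
move: Yx; rewrite ge_max => /andP[Yx x0]; exists x => //.
by apply: le_lt_trans gx; rewrite lerD2r le_psi // ler_wpM2r.
Qed.

(** By Mertens the sum of Lambda(n)/n over (x, lam x] is at least ln lam - 2 K = 1, whereas a gap,
    taken with del = 1, makes it less than 1. *)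
Lemma prime_gap_bounded (R : realType) : exists2 lam : R, 1 < lam & ~ prime_gap lam.
Proof.
have [K K0 HK] := mertens_real R; exists (expR (2 * K + 1)).
  by rewrite expR_gt1; lra.
move=> gap; have [x x1 gx] := gap 1 1 ltr01.
set lam := expR _ in gx; have l1 : 1 <= lam by rewrite ltW // expR_gt1; lra.
have xl : x <= lam * x by rewrite ler_peMl //; lra.
have := HK x x1; have := HK (lam * x) (le_trans x1 xl).
rewrite lnM ?posrE ?expR_gt0 //; last lra.
rewrite expRK !ler_norml => /andP[a1 _] /andP[_ b2].
set N := Num.truncn (lam * x) in a1 *; set N' := Num.truncn x in b2 *.
have NN : (N' <= N)%N by apply: le_truncn.
have : mangoldt_mass R N - mangoldt_mass R N' <= (psi (lam * x) - psi x) / x.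
  rewrite /mangoldt_mass /psi /chebyshev_psi -/N -/N'.
  rewrite !(@big_cat_nat _ _ _ N'.+1 1 N.+1) //= ![_ + _ - _]addrAC !subrr !add0r.
  rewrite mulr_suml; apply: ler_sum_nat => n /andP[n1 _].
  have rn : (0 : R) < n%:R by rewrite ltr0n (leq_ltn_trans _ n1).
  rewrite ler_wpM2l ?mangoldt_ge0 // lef_pV2 ?posrE //; last lra.
  by rewrite ltW // -truncn_lt_nat //; lra.
have : (psi (lam * x) - psi x) / x < 1 by rewrite ltr_pdivrMr; lra.
by lra.
Qed.

(** A gap of ratio mu gives dense intervals of ratio at least mu (1 + ln mu / 8), and these force a
    gap of that ratio. As mu >= lam, each round gains at least the factor c > 1, and the ratio
    passes every bound. *)
Lemma no_prime_gap (R : realType) (lam : R) : 1 < lam -> ~ prime_gap lam.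
Proof.
move=> l1 gap; have [M M1 nM] := prime_gap_bounded R.
have ll : 0 < ln lam by rewrite ln_gt0.
pose c := 1 + ln lam / 8.
have c1 : 1 < c by rewrite /c; lra.
have it k : prime_gap (lam * c ^+ k).
  elim: k => [|k IH]; first by rewrite expr0 mulr1.
  set mu := lam * c ^+ k in IH.
  have lm : lam <= mu by rewrite ler_peMr ?exprn_ege1 //; lra.
  have m1 : 1 < mu by lra.
  have lmu : 0 <= ln mu by rewrite ln_ge0 //; lra.
  have lll : ln lam <= ln mu by apply: le_ln_of; lra.
  have h := dense_primes_gap _ _ (prime_gap_dense m1 IH).
  apply: prime_gap_le (h _ _).
  - by rewrite exprSr mulrA -/mu ler_pM2l /c; lra.
  - by rewrite -[leLHS]mulr1 ler_pM; lra.
  - by rewrite exprn_ege1 //; lra.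
have Hc k : 1 + k%:R * (c - 1) <= c ^+ k.
  elim: k => [|k IH]; first by rewrite expr0 mul0r; lra.
  have ck : 0 <= k%:R * (c - 1) by rewrite mulr_ge0 //; lra.
  by rewrite exprS -natr1; nra.
pose k := (Num.truncn (M / (c - 1))).+1.
apply: nM; apply: prime_gap_le (it k).
have : M / (c - 1) < k%:R by apply: truncnS_gt.
rewrite ltr_pdivrMr; last lra.
move=> h; apply: (le_trans (ltW h)); apply: (@le_trans _ _ (c ^+ k)).
  by apply: le_trans (Hc k); rewrite lerDr.
by rewrite ler_peMl ?exprn_ge0 //; lra.
Qed.

(** * From von Mangoldt mass to primes *)

Lemma mangoldt_neq0 (R : realType) (n : nat) : mangoldt R n != 0 ->
  [/\ prime (pdiv n), (1 < n)%N & exists2 k, (0 < k)%N & n = (pdiv n ^ k)%N].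
Proof.
rewrite /mangoldt; case: ifP => [/eqP s|]; last by rewrite eqxx.
move=> _; case: n s => [//|n] s.
have n0 : (0 < n.+1)%N by [].
have n1 : (1 < n.+1)%N by case: n s n0.
have pp := pdiv_prime n1; split=> //.
have [m cpm E] := pfactor_coprime pp n0.
have a0 : (0 < logn (pdiv n.+1) n.+1)%N by rewrite logn_gt0 mem_primes pp n0 pdiv_dvd.
exists (logn (pdiv n.+1) n.+1) => //.
have m0 : (0 < m)%N by case: m E {cpm}.
have m1 : m = 1%N.
  move: s; rewrite {1}E mulnC (perm_size (perm_primes_pfactor pp cpm m0 a0)) /= => -[].
  move/eqP; rewrite size_eq0; case: (ltngtP m 1) m0 => // m1 _.
  by rewrite primes_eq0 ltnNge m1.
by rewrite {1}E m1 mul1n.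
Qed.

Lemma mangoldt_le_ln (R : realType) (n : nat) : (0 < n)%N -> mangoldt R n <= ln n%:R.
Proof.
move=> n0; rewrite /mangoldt; case: ifP => _; last by rewrite ln_ge0 // ler1n.
by apply: le_ln_of; rewrite ?ltr0n ?pdiv_gt0 // ler_nat pdiv_leq.
Qed.

(** Only proper prime powers remain. Two powers of one prime differ by a factor of at least 2 and
    cannot both lie in (M, N], so they are counted by their primes, which are at most sqrt N; each
    weighs at most ln N. *)
Lemma sum_mangoldt_nonprime (R : realType) (M N : nat) : (N <= M.*2)%N -> (0 < M)%N ->
  (forall p, prime p -> (M < p)%N -> (p <= N)%N -> False) ->
  \sum_(M.+1 <= n < N.+1) mangoldt R n <= (Num.sqrt N%:R + 1) * ln N%:R.
Proof.
move=> N2M M0 np; pose s := [seq n <- index_iota M.+1 N.+1 | mangoldt R n != 0].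
have sP n : n \in s -> [/\ (M < n <= N)%N, prime (pdiv n) &
    exists2 k, (1 < k)%N & n = (pdiv n ^ k)%N].
  rewrite mem_filter mem_index_iota ltnS => /andP[/mangoldt_neq0[pp n1 [k k0 E]] nMN].
  split=> //; exists k => //; case: k k0 E => [|[|k]] // _ E.
  by exfalso; move: nMN; rewrite E expn1 => /andP[]; exact: np.
have us : uniq (map pdiv s).
  rewrite map_inj_in_uniq ?filter_uniq ?iota_uniq // => n n' /sP[/andP[a b] pp [k k1 E]].
  move=> /sP[/andP[a' b'] _ [k' k'1 E']] e.
  have H (p : nat) i j : prime p -> (i < j)%N -> (M < p ^ i)%N -> (p ^ j <= N)%N -> False.
    move=> pr ij h1 h2; have : (p ^ i.+1 <= p ^ j)%N by rewrite leq_exp2l ?prime_gt1.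
    rewrite expnS; have : (2 * p ^ i <= p * p ^ i)%N by rewrite leq_mul2r prime_gt1 ?orbT.
    by move: N2M; rewrite -mul2n; lia.
  rewrite E E' -e; case: (ltngtP k k') => [kk|kk|->] //; exfalso.
    by apply: (H (pdiv n) k k'); rewrite -?E // e -E'.
  by apply: (H (pdiv n) k' k); rewrite -?E // e -E'.
set r := Num.truncn (Num.sqrt N%:R : R).
have sz : (size s <= r.+1)%N.
  rewrite -(size_map pdiv s) -(size_iota 0 r.+1); apply: uniq_leq_size => // p.
  move=> /mapP[n /sP[/andP[_ nN] pp [k k1 E]] ->]; rewrite mem_iota add0n /= ltnS.
  rewrite truncn_ge_nat ?sqrtr_ge0 // -[leLHS]ger0_norm // -sqrtr_sqr.
  rewrite ler_sqrt // -natrX ler_nat; apply: leq_trans nN.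
  by rewrite {2}E leq_exp2l // prime_gt1.
have r1 : (r.+1)%:R <= Num.sqrt N%:R + 1 :> R.
  by rewrite -natr1 lerD2r truncn_le sqrtr_ge0.
have lN : 0 <= ln N%:R :> R.
  by case: (N) => [|n]; [rewrite ln0 | rewrite ln_ge0 // ler1n].
apply: le_trans (_ : (size s)%:R * ln N%:R <= _); last first.
  by rewrite ler_wpM2r // (le_trans _ r1) // ler_nat.
have -> : \sum_(M.+1 <= n < N.+1) mangoldt R n = \sum_(n <- s) mangoldt R n.
  rewrite /s big_filter [RHS]big_mkcond /=; apply: eq_bigr => n _.
  by case: eqP.
apply: le_trans (_ : \sum_(n <- s) ln N%:R <= _); last first.
  by rewrite big_const_seq count_predT iter_addr_0 mulr_natl.
rewrite big_seq [leRHS]big_seq; apply: ler_sum => n /sP[/andP[Mn nN] _ _].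
have n0 : (0 < n)%N by apply: leq_ltn_trans Mn.
by apply: le_trans (mangoldt_le_ln R n0) _; rewrite le_ln_of ?ltr0n ?ler_nat.
Qed.

(** As there is no gap, (N, (1 + e) N] has mass at least del N; if it had no primes, its mass would
    be O(sqrt N ln N). *)
Lemma prime_in_short_interval (R : realType) (eps : R) : 0 < eps ->
  exists2 X : nat, (0 < X)%N & forall N, (X <= N)%N ->
  exists p, [/\ prime p, (N < p)%N & p%:R <= (1 + eps) * N%:R].
Proof.
(* The cap at 1 keeps the interval inside (N, 2 N], as [sum_mangoldt_nonprime] requires. *)
move=> eps0; pose e := Order.min eps 1.
have e0 : 0 < e by rewrite lt_min eps0 ltr01.
have e1 : e <= 1 by rewrite ge_min lexx orbT.
have ee : e <= eps by rewrite ge_min lexx.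
have ngap : ~ prime_gap (1 + e) by apply: no_prime_gap; lra.
have [del [Y [d0 H]]] : exists del Y : R, 0 < del /\
    forall x, Y <= x -> del * x <= psi ((1 + e) * x) - psi x.
  apply: contrapT => h; apply: ngap => del Y d0; apply: contrapT => h'; apply: h.
  exists del, Y; split=> // x Yx; rewrite leNgt; apply/negP => lt.
  by apply: h'; exists x.
(* With T = t^4 the two bounds on the mass give del t^4 <= 16 t^3, impossible once t > D. *)
pose D := 32 / del.
have D0 : 0 < D by rewrite divr_gt0.
exists (Num.truncn (Order.max Y 0 + D ^+ 4)).+1 => // N XN; apply: contrapT => nop.
have {XN} : Order.max Y 0 + D ^+ 4 < N%:R.
  by apply: lt_le_trans (truncnS_gt _) _; rewrite ler_nat.
have mY : Y <= Order.max Y 0 by rewrite le_max lexx.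
have m0 : 0 <= Order.max Y 0 by rewrite le_max lexx orbT.
have D4 : 0 < D ^+ 4 by rewrite exprn_gt0.
move=> XN; have YN : Y <= N%:R by lra.
have rN : (0 : R) < N%:R by lra.
have N0 : (0 < N)%N by rewrite -(ltr0n R).
set T := Num.truncn ((1 + e) * N%:R).
have T0 : 0 <= (1 + e) * N%:R by rewrite mulr_ge0; lra.
have T2 : (T <= N.*2)%N.
  rewrite -(ler_nat R); apply: le_trans (_ : (1 + e) * N%:R <= _).
    by rewrite truncn_le.
  by rewrite -mul2n natrM ler_pM2r //; lra.
have NT : (N <= T)%N by rewrite truncn_ge_nat // ler_peMl //; lra.
have h : psi ((1 + e) * N%:R) - psi N%:R <= (Num.sqrt T%:R + 1) * ln T%:R.
  rewrite /psi natrK -/T /chebyshev_psi (@big_cat_nat _ _ _ N.+1 1 T.+1) //=.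
  rewrite addrAC subrr add0r; apply: sum_mangoldt_nonprime => // p pp Np pT.
  apply: nop; exists p; split=> //; apply: le_trans (_ : (1 + e) * N%:R <= _).
    by rewrite -truncn_ge_nat.
  by rewrite ler_pM2r //; lra.
have {h} := le_trans (H _ YN) h.
have rT : (0 : R) < T%:R by rewrite ltr0n (leq_trans N0).
have T2r : T%:R <= 2 * N%:R :> R by rewrite -natrM ler_nat mul2n.
have T1 : (1 : R) <= T%:R by rewrite ler1n (leq_trans N0).
set s := Num.sqrt T%:R; set t := Num.sqrt s.
have s1 : 1 <= s by rewrite -[leLHS]sqrtr1 ler_sqrt.
have t1 : 1 <= t by rewrite -[leLHS]sqrtr1 ler_sqrt //; lra.
have Es : s = t ^+ 2 by rewrite sqr_sqrtr //; lra.
have ET : T%:R = t ^+ 4 :> R by rewrite (exprM t 2 2) -Es sqr_sqrtr // ltW.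
have t0 : 0 < t by lra.
have lt := le_ln_id t0.
have -> : ln T%:R = 4 * ln t by rewrite ET lnXn // mulr_natl.
rewrite Es => h.
have tD : D < t.
  rewrite ltNge; apply/negP => tD.
  have : t ^+ 4 <= D ^+ 4 by rewrite lerXn2r // nnegrE ltW.
  have : N%:R <= T%:R :> R by rewrite ler_nat.
  by rewrite ET; lra.
rewrite ltr_pdivrMr // in tD.
have h1 : (t ^+ 2 + 1) * (4 * ln t) <= 8 * t ^+ 3.
  apply: le_trans (_ : (2 * t ^+ 2) * (4 * t) <= _); last by rewrite le_eqVlt; apply/orP; left; apply/eqP; ring.
  apply: ler_pM; [nra | | nra | lra].
  by rewrite mulr_ge0 // ln_ge0.
have h2 : del * t ^+ 4 <= 16 * t ^+ 3.
  rewrite -ET; apply: le_trans (_ : del * (2 * N%:R) <= _); first by rewrite ler_pM2l.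
  by lra.
have t3 : 0 < t ^+ 3 by rewrite exprn_gt0.
have : t ^+ 3 * 32 < t ^+ 3 * (t * del) by rewrite ltr_pM2l.
have -> : t ^+ 3 * (t * del) = del * t ^+ 4 by ring.
by lra.
Qed.

(** * Cliques and polynomials *)

Definition is_clique (T : finType) (adj : rel T) (C : {set T}) : bool :=
  [forall x in C, forall y in C, (x != y) ==> adj x y].

(* Peeling off a maximal clique [C] lowers the rank: the product over [C] is a
   vector of the row space which lives on [C] alone. *)
Lemma clique_rank (F : fieldType) (T : finType) (adj : rel T) (k d : nat)
    (Q : 'I_d -> T -> F) (S : {set T}) :
  symmetric adj ->
  (forall C : {set T}, C \subset S -> is_clique adj C -> (#|C| <= k)%N ->
     exists a : 'rV[F]_d, forall y, y \in S ->
     (\sum_i a 0 i * Q i y != 0 <-> forall c, c \in C -> (y == c) || adj c y)) ->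
  (forall C : {set T}, C \subset S -> is_clique adj C -> (#|C| <= k)%N) ->
  (#|S| <= k * d)%N.
Proof.
move=> adjC span.
pose E (S : {set T}) : 'M[F]_(d, #|T|) :=
  \matrix_(i, j) (Q i (enum_val j) *+ (enum_val j \in S)).
(* The induction runs over the subsets S' left after peeling; the rank of [E S'] bounds the number
   of peelings still to come. *)
move=> HS0; suff H : forall n (S' : {set T}), S' \subset S -> (#|S'| <= n)%N ->
    (#|S'| <= k * \rank (E S'))%N.
  apply: leq_trans (H _ S (fintype.subxx _) (leqnn _)) _.
  by rewrite leq_mul2l rank_leq_row orbT.
move: S HS0 span => S0 HS0 span.
elim=> [|n IH] S S0S Sn; first by move: Sn; rewrite leqn0 => /eqP ->.
have HS (C : {set T}) : C \subset S -> is_clique adj C -> (#|C| <= k)%N.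
  by move=> CS; apply: HS0; apply: fintype.subset_trans CS S0S.
have inS0 y : y \in S -> y \in S0 by apply: (fintype.subsetP S0S).
have [->|[x xS]] := set_0Vmem S; first by rewrite cards0.
pose P (C : {set T}) := (C \subset S) && is_clique adj C.
have P1 : P [set x].
  rewrite /P finset.sub1set xS /=; apply/forall_inP => y /set1P ->; apply/forall_inP => z /set1P ->.
  by rewrite eqxx.
have [C /maxsetP[/andP[CS clC] Cmax] xC] := maxset_exists P1.
rewrite finset.sub1set in xC.
have [a Ha] := span C (fintype.subset_trans CS S0S) clC (HS C CS clC).
have maxC y : y \in S -> (forall c, c \in C -> (y == c) || adj c y) -> y \in C.
  move=> yS yC; apply: contraT => nyC.
  have adjy c : c \in C -> adj c y.
    by move=> cC; have := yC c cC; case: eqP => // yc; rewrite yc cC in nyC.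
  suff E' : y |: C = C by move: nyC; rewrite -E' finset.setU11.
  apply: Cmax; last exact: finset.subsetUr.
  rewrite /P finset.subUset finset.sub1set yS CS /=.
  apply/forall_inP => u uC; apply/forall_inP => v vC; apply/implyP => uv.
  move: uC vC uv; rewrite !finset.in_setU1 => /predU1P[->|uC] /predU1P[->|vC]; rewrite ?eqxx //.
  - by rewrite adjC adjy.
  - by rewrite adjy.
  by move: clC => /forall_inP/(_ u uC)/forall_inP/(_ v vC)/implyP.
have onC y : y \in C -> \sum_i a 0 i * Q i y != 0.
  move=> yC; apply/(Ha y (inS0 _ (fintype.subsetP CS _ yC))) => c cC.
  have [//|yc] := eqVneq y c.
  by move: clC => /forall_inP/(_ c cC)/forall_inP/(_ y yC)/implyP; apply; rewrite eq_sym.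
pose B : 'M[F]_#|T| := diag_mx (\row_j (enum_val j \in S :\: C)%:R).
have EB : E (S :\: C) = E S *m B.
  rewrite mul_mx_diag; apply/matrixP => i j; rewrite !mxE finset.in_setD.
  by case: (enum_val j \in C); case: (enum_val j \in S); rewrite /= ?mulr1 ?mulr0 ?mulr0n ?mul0r.
pose u := a *m E S.
have uE j : u 0 j = (\sum_i a 0 i * Q i (enum_val j)) *+ (enum_val j \in S).
  by rewrite mxE -sumrMnl; apply: eq_bigr => i _; rewrite mxE mulrnAr.
have u0 : u != 0.
  apply/eqP => /rowP /(_ (enum_rank x)); rewrite uE mxE enum_rankK xS.
  by move/eqP; rewrite (negPf (onC x xC)).
(* By maximality of C the nonzero vector u is supported on C. Erasing the columns of C therefore
   kills it, and the rank drops. *)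
have uK : (u <= E S :&: kermx B)%MS.
  rewrite sub_capmx submxMl; apply/sub_kermxP; rewrite mul_mx_diag.
  apply/rowP => j; rewrite mxE uE !mxE finset.in_setD.
  have [jC|jC] /= := boolP (enum_val j \in C); first by rewrite mulr0.
  have [jS|jS] := boolP (enum_val j \in S); last by rewrite mulr0.
  rewrite mulr1; apply/eqP/negPn/negP => /(Ha _ (inS0 _ jS)) /(maxC _ jS).
  exact/negP.
have rk : (\rank (E (S :\: C)) < \rank (E S))%N.
  rewrite EB -(mxrank_mul_ker (E S) B) -addn1 leq_add2l.
  by apply: leq_trans (mxrankS uK); rewrite lt0n mxrank_eq0.
have cC : (0 < #|C|)%N by apply/card_gt0P; exists x.
have cS := cardsID C S; have CI : S :&: C = C by apply/finset.setIidPr.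
rewrite CI in cS.
have IH' : (#|S :\: C| <= k * \rank (E (S :\: C)))%N.
  apply: IH; last by lia.
  by apply: fintype.subset_trans S0S; apply: finset.subsetDl.
have := HS C CS clC; have : (k * (\rank (E (S :\: C))).+1 <= k * \rank (E S))%N.
  by rewrite leq_mul2l rk orbT.
by rewrite mulnS; lia.
Qed.

(** * Reduced polynomials of low degree on words *)

Definition monomial (F : comNzRingType) (n l : nat) (w : 'I_l -> F)
    (e : {ffun 'I_n -> 'I_l}) (y : {ffun 'I_n -> 'I_l}) : F :=
  \prod_i w (y i) ^+ e i.

(** Exponents stay below l, the number of letters: by [top_power_reduction] this loses no polynomial
    function, and it gives the monomials the generating function (1 + t + ... + t^(l-1))^n. *)
Definition low_degree (F : comNzRingType) (n l : nat) (w : 'I_l -> F) (D : nat)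
    (g : {ffun 'I_n -> 'I_l} -> F) : Prop :=
  exists2 a : {ffun 'I_n -> 'I_l} -> F,
    (forall e : {ffun 'I_n -> 'I_l}, (D < \sum_i e i)%N -> a e = 0) &
    forall y, g y = \sum_e a e * monomial w e y.

Lemma low_degree_ext (F : comNzRingType) (n l : nat) (w : 'I_l -> F) D
    (g h : {ffun 'I_n -> 'I_l} -> F) :
  g =1 h -> low_degree w D g -> low_degree w D h.
Proof. by move=> gh [a a0 ag]; exists a => // y; rewrite -gh. Qed.

Lemma low_degree_le (F : comNzRingType) (n l : nat) (w : 'I_l -> F) D D'
    (g : {ffun 'I_n -> 'I_l} -> F) :
  (D <= D')%N -> low_degree w D g -> low_degree w D' g.
Proof. by move=> DD [a a0 ag]; exists a => // e De; apply: a0; apply: leq_ltn_trans De. Qed.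

Lemma low_degreeD (F : comNzRingType) (n l : nat) (w : 'I_l -> F) D
    (g h : {ffun 'I_n -> 'I_l} -> F) :
  low_degree w D g -> low_degree w D h -> low_degree w D (fun y => g y + h y).
Proof.
move=> [a a0 ag] [b b0 bh]; exists (fun e => a e + b e).
  by move=> e De; rewrite a0 // b0 // addr0.
by move=> y; rewrite ag bh -big_split /=; apply: eq_bigr => e _; rewrite mulrDl.
Qed.

Lemma low_degreeZ (F : comNzRingType) (n l : nat) (w : 'I_l -> F) D c
    (g : {ffun 'I_n -> 'I_l} -> F) :
  low_degree w D g -> low_degree w D (fun y => c * g y).
Proof.
move=> [a a0 ag]; exists (fun e => c * a e); first by move=> e De; rewrite a0 // mulr0.
by move=> y; rewrite ag mulr_sumr; apply: eq_bigr => e _; rewrite mulrA.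
Qed.

Lemma low_degree_monomial (F : comNzRingType) (n l : nat) (w : 'I_l -> F) D
    (e : {ffun 'I_n -> 'I_l}) :
  (\sum_i e i <= D)%N -> low_degree w D (monomial w e).
Proof.
move=> eD; exists (fun e' => (e' == e)%:R) => [e' De'|y].
  by case: eqP => // ee; move: De'; rewrite ee ltnNge eD.
rewrite (bigD1 e) //= eqxx mul1r big1 ?addr0 // => e' /negPf ->; by rewrite mul0r.
Qed.

Lemma low_degree0 (F : comNzRingType) (n l : nat) (w : 'I_l -> F) D :
  low_degree w D (fun _ : {ffun 'I_n -> 'I_l} => 0).
Proof. by exists (fun=> 0) => // y; rewrite big1 // => e _; rewrite mul0r. Qed.

Lemma low_degree_sum (F : comNzRingType) (n l : nat) (w : 'I_l -> F) D
    (I : Type) (r : seq I) (g : I -> {ffun 'I_n -> 'I_l} -> F) :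
  (forall i, low_degree w D (g i)) -> low_degree w D (fun y => \sum_(i <- r) g i y).
Proof.
move=> Hg; elim: r => [|i r IH].
  by apply: low_degree_ext (@low_degree0 _ _ _ _ _) => y; rewrite big_nil.
by apply: low_degree_ext (low_degreeD (Hg i) IH) => y; rewrite big_cons.
Qed.

Lemma low_degree_cst (F : comNzRingType) (n l : nat) (w : 'I_l -> F) D c :
  (0 < l)%N -> low_degree w D (fun _ : {ffun 'I_n -> 'I_l} => c).
Proof.
case: l w => // l w _; apply: (@low_degree_ext _ _ _ _ _ (fun y => c * monomial w [ffun=> ord0] y)).
  by move=> y; rewrite /monomial big1 ?mulr1 // => i _; rewrite ffunE expr0.
apply: low_degreeZ; apply: low_degree_monomial.
by rewrite big1 // => i _; rewrite ffunE.
Qed.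

(** Every [w j] is a root of the monic polynomial of degree l whose roots are the values of w. *)
Lemma top_power_reduction (F : comNzRingType) (l : nat) (w : 'I_l -> F) :
  exists b : 'I_l -> F, forall j, w j ^+ l = \sum_(i < l) b i * w j ^+ i.
Proof.
pose q := \prod_(j < l) ('X - (w j)%:P).
have sq : size q = l.+1 by rewrite /q -big_enum size_prod_XsubC size_enum_ord.
have mq : q \is monic by apply: monic_prod_XsubC.
exists (fun i => - q`_i) => j.
have : q.[w j] = 0.
  by rewrite horner_prod (bigD1 j) //= !hornerE subrr mul0r.
rewrite horner_coef sq big_ord_recr /=.
have -> : q`_l = 1 by move/monicP: mq; rewrite /lead_coef sq.
move=> /eqP; rewrite mul1r addrC addr_eq0 => /eqP ->; rewrite -sumrN.
by apply: eq_bigr => i _; rewrite mulNr.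
Qed.

(** The exponent of the i-th letter grows by one; if it reaches l, [top_power_reduction] replaces it
    by smaller exponents, so the degree stays at most D + 1. *)
Lemma low_degreeX (F : comNzRingType) (n l : nat) (w : 'I_l -> F) D (i : 'I_n)
    (g : {ffun 'I_n -> 'I_l} -> F) :
  low_degree w D g -> low_degree w D.+1 (fun y => w (y i) * g y).
Proof.
move=> [a a0 ag].
apply: (@low_degree_ext _ _ _ _ _ (fun y => \sum_e a e * (w (y i) * monomial w e y))).
  by move=> y; rewrite ag mulr_sumr; apply: eq_bigr => e _; rewrite mulrCA.
apply: low_degree_sum => e; have [De|eD] := ltnP D (\sum_j e j).
  by apply: low_degree_ext (@low_degree0 _ _ _ _ _) => y; rewrite a0 // mul0r.
apply: low_degreeZ.
pose upd (j : 'I_l) : {ffun 'I_n -> 'I_l} := [ffun i' => if i' == i then j else e i'].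
have updE j y : monomial w (upd j) y = w (y i) ^+ j * \prod_(i' | i' != i) w (y i') ^+ e i'.
  rewrite /monomial (bigD1 i) //= ffunE eqxx; congr (_ * _).
  by apply: eq_bigr => i' /negPf ni; rewrite ffunE ni.
have updD (j : 'I_l) : (j <= (e i).+1)%N -> (\sum_i' upd j i' <= D.+1)%N.
  move=> je; rewrite (bigD1 i) //= ffunE eqxx.
  rewrite (eq_bigr (fun i' => e i' : nat)); last by move=> i' /negPf ni; rewrite ffunE ni.
  apply: leq_trans (_ : (\sum_j e j).+1 <= _)%N; last by [].
  by rewrite [X in (_ <= X.+1)%N](bigD1 i) //= -addSn leq_add2r.
have eE (y : {ffun 'I_n -> 'I_l}) : w (y i) * monomial w e y = w (y i) ^+ (e i).+1 * \prod_(i' | i' != i) w (y i') ^+ e i'.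
  by rewrite /monomial (bigD1 i) //= mulrA exprS.
have [el|le] := ltnP (e i).+1 l.
  apply: low_degree_ext (low_degree_monomial w (updD (Ordinal el) (leqnn _))) => y.
  by rewrite eE updE.
have El : (e i).+1 = l by apply/eqP; rewrite eqn_leq ltn_ord.
have [b Hb] := top_power_reduction w.
apply: (@low_degree_ext _ _ _ _ _ (fun y => \sum_(j < l) b j * monomial w (upd j) y)).
  move=> y; rewrite eE El Hb mulr_suml; apply: eq_bigr => j _.
  by rewrite updE mulrA.
apply: low_degree_sum => j; apply: low_degreeZ; apply: low_degree_monomial.
by apply: updD; rewrite El ltnW.
Qed.

Lemma low_degree_affine (F : comNzRingType) (n l : nat) (w : 'I_l -> F) D
    (c0 : F) (c : 'I_n -> F) (r : nat) (g : {ffun 'I_n -> 'I_l} -> F) :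
  low_degree w D g ->
  low_degree w (D + r) (fun y => (c0 + \sum_i c i * w (y i)) ^+ r * g y).
Proof.
move=> Hg; elim: r => [|r IH].
  by rewrite addn0; apply: low_degree_ext Hg => y; rewrite expr0 mul1r.
set h := (fun y => _ ^+ r * g y) in IH.
apply: (@low_degree_ext _ _ _ _ _ (fun y => c0 * h y + \sum_i c i * (w (y i) * h y))).
  move=> y; rewrite exprS -mulrA -/(h y) mulrDl mulr_suml; congr (_ + _).
  by apply: eq_bigr => i _; rewrite mulrA.
rewrite addnS; apply: low_degreeD.
  by apply: low_degreeZ; apply: low_degree_le IH.
by apply: low_degree_sum => i; apply: low_degreeZ; apply: low_degreeX.
Qed.

Lemma low_degree_prod_clique (F : comNzRingType) (n l : nat) (w : 'I_l -> F) (r : nat)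
    (I : Type) (s : seq I) (c0 : I -> F) (c : I -> 'I_n -> F) : (0 < l)%N ->
  low_degree w (size s * r)
    (fun y => \prod_(x <- s) (1 - (c0 x + \sum_i c x i * w (y i)) ^+ r)).
Proof.
move=> l0; elim: s => [|x s IH].
  by apply: low_degree_ext (@low_degree_cst _ _ _ _ 0 1 l0) => y; rewrite big_nil.
set h := (fun y => \prod_(x <- s) _) in IH.
apply: (@low_degree_ext _ _ _ _ _ (fun y => h y +
   (-1) * ((c0 x + \sum_i c x i * w (y i)) ^+ r * h y))).
  by move=> y; rewrite big_cons -/(h y); ring.
rewrite /= mulSn addnC; apply: low_degreeD.
  by apply: low_degree_le IH; rewrite leq_addr.
by apply: low_degreeZ; apply: low_degree_affine.
Qed.

(** * Words with small entries *)

(* Enumerates 0, 1, -1, 2, -2, and so on. *)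
Definition alternating (j : nat) : int := if odd j then j./2.+1%:Z else - j./2%:Z.

Definition inner_prod (n l : nat) (x y : {ffun 'I_n -> 'I_l}) : int :=
  \sum_i alternating (x i) * alternating (y i).

(** The letter costs are the exponents of the truncated theta function; the order of [alternating]
    is the one in which the cost of the letter a is 2 a^2 - a. *)
Definition weight (n l : nat) (x : {ffun 'I_n -> 'I_l}) : nat := \sum_i 'C((x i).+1, 2).

Lemma alternating_bin (j : nat) :
  ('C(j.+1, 2)%:Z = 2 * alternating j ^+ 2 - alternating j)%R.
Proof.
rewrite bin2 /= /alternating -{1 2}[j]odd_double_half; case: (odd j); set h := j./2.
  have -> : ((true + h.*2).+1 * (true + h.*2) = (h.+1 * h.*2.+1).*2)%N.
    by rewrite -!mul2n /=; lia.
  rewrite doubleK; lia.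
have -> : ((false + h.*2).+1 * (false + h.*2) = (h * h.*2.+1).*2)%N.
  by rewrite -!mul2n /=; lia.
rewrite doubleK; lia.
Qed.

Lemma alternating_inj : injective alternating.
Proof.
move=> i j; have := odd_double_half i; have := odd_double_half j.
by rewrite /alternating; case: (odd i); case: (odd j); rewrite -!mul2n; lia.
Qed.

(** The right side minus the left is s^2 - s with s = a + b, nonnegative because s is an integer. *)
Lemma alternating_sqr_sub (i j : nat) :
  (alternating i - alternating j) ^+ 2 <= 'C(i.+1, 2)%:Z + 'C(j.+1, 2)%:Z.
Proof.
rewrite !alternating_bin; move: (alternating i) (alternating j) => a b.
have h : a + b <= (a + b) ^+ 2.
  have [s0|s1] := lerP (a + b) 0; first by apply: le_trans s0 (sqr_ge0 _).
  by rewrite expr2 ler_peMr // ltW.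
by rewrite -subr_ge0 (_ : _ - _ = (a + b) ^+ 2 - (a + b)) ?subr_ge0 //; ring.
Qed.

Lemma sum_sqr_sub (n l : nat) (x y : {ffun 'I_n -> 'I_l}) :
  \sum_i (alternating (x i) - alternating (y i)) ^+ 2 =
  inner_prod x x + inner_prod y y - 2 * inner_prod x y.
Proof.
rewrite /inner_prod mulr_sumr -big_split -sumrB /=; apply: eq_bigr => i _; ring.
Qed.

(** The square |x - y|^2 equals 2 (N - <x, y>), and [alternating_sqr_sub] bounds it by the sum 2 B
    of the two weights. *)
Lemma inner_prod_bounds (n l : nat) (N : int) (B : nat) (x y : {ffun 'I_n -> 'I_l}) :
  inner_prod x x = N -> inner_prod y y = N -> weight x = B -> weight y = B ->
  0 <= N - inner_prod x y <= B%:Z.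
Proof.
move=> xN yN xB yB; have := sum_sqr_sub x y; rewrite xN yN => E.
have h0 : 0 <= \sum_i (alternating (x i) - alternating (y i)) ^+ 2.
  by apply: sumr_ge0 => i _; exact: sqr_ge0.
have h1 : \sum_i (alternating (x i) - alternating (y i)) ^+ 2 <= (B + B)%:Z.
  rewrite -{1}xB -yB /weight -big_split /= -natz natr_sum.
  apply: ler_sum => i _; rewrite natz PoszD; exact: alternating_sqr_sub.
by rewrite E in h0 h1; apply/andP; split; lia.
Qed.

Lemma inner_prod_eq (n l : nat) (N : int) (x y : {ffun 'I_n -> 'I_l}) :
  inner_prod x x = N -> inner_prod y y = N -> N - inner_prod x y = 0 -> x = y.
Proof.
move=> xN yN z0; have := sum_sqr_sub x y; rewrite xN yN.
rewrite (_ : N + N - _ = 0); last by lia.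
move/psumr_eq0P => h; apply/ffunP => i; apply/val_inj/alternating_inj/eqP.
by rewrite -subr_eq0 -sqrf_eq0; apply/eqP/h => // j _; exact: sqr_ge0.
Qed.

Definition div_adj (n l : nat) (N : int) (p : nat) (x y : {ffun 'I_n -> 'I_l}) : bool :=
  (p%:Z %| N - inner_prod x y)%Z.

(** By Fermat, 1 - (N - <x, y>)^(p-1) is over F_p the indicator of [div_adj], and it has degree at
    most p - 1 in the letters of y. Its products over cliques of at most k points feed
    [clique_rank]. *)
Lemma clique_bound (n l p k : nat) (N : int) (S : {set {ffun 'I_n -> 'I_l}}) :
  prime p -> (0 < l)%N ->
  (forall x, x \in S -> inner_prod x x = N) ->
  (forall C : {set {ffun 'I_n -> 'I_l}}, C \subset S ->
     is_clique (div_adj N p) C -> (#|C| <= k)%N) ->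
  (#|S| <= k * #|[set e : {ffun 'I_n -> 'I_l} | \sum_i e i <= k * p.-1]|)%N.
Proof.
move=> pp l0 SN HS; set M := [set e | _].
pose w (j : 'I_l) : 'F_p := (alternating j)%:~R.
have pF : p \in [pchar 'F_p] by apply: pchar_Fp.
pose f (x y : {ffun 'I_n -> 'I_l}) : 'F_p :=
  1 - (N%:~R + \sum_i (- w (x i)) * w (y i)) ^+ p.-1.
have fE x y : f x y = 1 - ((N - inner_prod x y)%:~R) ^+ p.-1.
  rewrite /f /inner_prod rmorphB rmorph_sum /= -sumrN; congr (1 - (_ + _) ^+ _).
  by apply: eq_bigr => i _; rewrite mulNr rmorphM.
have fneq0 x y : (f x y != 0) = div_adj N p x y.
  rewrite fE /div_adj (dvdz_pcharf pF); set z : 'F_p := _%:~R.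
  have [->|z0] := eqVneq z 0.
    have p1 : (p.-1 == 0)%N = false by move: (prime_gt1 pp); case: (p) => [|[]].
    by rewrite expr0n p1 subr0 oner_neq0.
  have -> : z ^+ p.-1 = 1.
    apply: (mulfI z0); rewrite -exprS prednK ?prime_gt0 // mulr1.
    by rewrite -[X in _ ^+ X](card_Fp pp) expf_card.
  by rewrite subrr eqxx.
apply: (@clique_rank 'F_p _ (div_adj N p) k #|M| (fun i y => monomial w (enum_val i) y)) HS.
  move=> x y; rewrite /div_adj /inner_prod.
  by congr (_ %| _ - _)%Z; apply: eq_bigr => i _; rewrite mulrC.
move=> C CS clC Ck.
have := @low_degree_prod_clique 'F_p n l w p.-1 _ (enum C) (fun=> N%:~R)
  (fun x i => - w (x i)) l0.
rewrite -cardE => -[a a0 ag].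
exists (\row_i a (enum_val i)) => y yS.
have P : \prod_(x in C) f x y = \sum_e a e * monomial w e y by rewrite -big_enum -ag.
(* Monomials of degree above k (p - 1) have coefficient zero, so those in M suffice. *)
have -> : \sum_(i < #|M|) (\row_i a (enum_val i)) 0 i * monomial w (enum_val i) y =
    \prod_(x in C) f x y.
  rewrite P [RHS](bigID (mem M)) /= [X in _ = _ + X]big1 ?addr0.
    by rewrite [RHS]big_enum_val; apply: eq_bigr => i _; rewrite mxE.
  move=> e; rewrite finset.in_set -ltnNge => De; rewrite a0 ?mul0r //.
  by apply: leq_ltn_trans De; rewrite leq_mul2r Ck orbT.
have refl c : c \in S -> div_adj N p c c.
  by move=> cS; rewrite /div_adj SN // subrr dvdz0.
split=> [/prodf_neq0 h c cC|h]; first by rewrite -fneq0 h ?orbT.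
apply/prodf_neq0 => c cC; rewrite fneq0; case/orP: (h c cC) => // /eqP ->.
by apply: refl; apply: (fintype.subsetP CS).
Qed.

(** * Counting by generating functions *)

Lemma expr_sum_ffun (R : comPzRingType) (n l : nat) (F : 'I_l -> R) :
  (\sum_j F j) ^+ n = \sum_(x : {ffun 'I_n -> 'I_l}) \prod_i F (x i).
Proof. by rewrite -[n in LHS]card_ord -prodr_const bigA_distr_bigA. Qed.

(** Rankin's trick: of the expanded power keep the exponent vectors of degree at most D, each worth
    at least t^D since t <= 1. *)
Lemma card_low_degree (R : realType) (n l D : nat) (t : R) : 0 < t -> t <= 1 ->
  #|[set e : {ffun 'I_n -> 'I_l} | (\sum_i e i <= D)%N]|%:R * t ^+ D
    <= (\sum_(j < l) t ^+ j) ^+ n.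
Proof.
move=> t0 t1; rewrite expr_sum_ffun.
rewrite [leRHS](bigID (fun e : {ffun 'I_n -> 'I_l} => \sum_i e i <= D)%N) /=.
rewrite -[leLHS]addr0; apply: lerD; last first.
  by apply: sumr_ge0 => e _; apply: prodr_ge0 => i _; rewrite exprn_ge0 // ltW.
rewrite mulr_natl -sumr_const big_mkcond [leRHS]big_mkcond; apply: ler_sum => e _.
rewrite finset.in_set; case: ifP => // eD.
by rewrite prodrXr ler_wiXn2l // ltW.
Qed.

Lemma sum_weight (R : realType) (n l : nat) (s : R) :
  \sum_(x : {ffun 'I_n -> 'I_l}) s ^+ weight x = (\sum_(j < l) s ^+ 'C(j.+1, 2)) ^+ n.
Proof.
rewrite expr_sum_ffun.
by apply: eq_bigr => x _; rewrite prodrXr.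
Qed.

Lemma alternating_sqr_le (j : nat) : alternating j ^+ 2 <= 'C(j.+1, 2)%:Z.
Proof.
rewrite alternating_bin; have h : alternating j <= alternating j ^+ 2.
  have [s0|s1] := lerP (alternating j) 0; first by apply: le_trans s0 (sqr_ge0 _).
  by rewrite expr2 ler_peMr // ltW.
by rewrite -subr_ge0 (_ : _ - _ = alternating j ^+ 2 - alternating j) ?subr_ge0 //; ring.
Qed.

Lemma weight_le (n l : nat) (x : {ffun 'I_n -> 'I_l}) : (weight x <= n * l ^ 2)%N.
Proof.
rewrite /weight -[n in leqRHS]card_ord -sum_nat_const; apply: leq_sum => i _.
rewrite bin2 -divn2; apply: leq_trans (leq_div _ _) _.
by rewrite -mulnn; apply: leq_mul; [exact: ltn_ord | exact: ltnW (ltn_ord _)].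
Qed.

Lemma inner_prod_self_le (n l : nat) (x : {ffun 'I_n -> 'I_l}) :
  0 <= inner_prod x x <= (weight x)%:Z.
Proof.
apply/andP; split; first by apply: sumr_ge0 => i _; rewrite -expr2 sqr_ge0.
rewrite /weight -natz natr_sum; apply: ler_sum => i _.
by rewrite natz -expr2 alternating_sqr_le.
Qed.

(** Pigeonhole: squared length and weight take together at most (n l^2 + 1)^2 values, so the
    heaviest class carries at least that fraction of the total in [sum_weight]. *)
Lemma heavy_sphere (R : realType) (n l : nat) (s : R) : 0 < s ->
  exists N B, (B <= n * l ^ 2)%N /\
    (\sum_(j < l) s ^+ 'C(j.+1, 2)) ^+ n <= (n * l ^ 2).+1%:R ^+ 2 *
     (#|[set x : {ffun 'I_n -> 'I_l} | (inner_prod x x == N) && (weight x == B)]|%:R * s ^+ B).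
Proof.
move=> s0; set q := (n * l ^ 2)%N.
(* Both invariants are at most q, so [inord] never falls back to its default. *)
pose cls (x : {ffun 'I_n -> 'I_l}) : 'I_q.+1 * 'I_q.+1 :=
  (inord `|inner_prod x x|%N, inord (weight x)).
pose g c := \sum_(x | cls x == c) s ^+ weight x.
have [c Hc] : exists c, forall c', g c' <= g c.
  case: (@arg_maxP _ _ _ (ord0, ord0) xpredT g isT) => c _ H.
  by exists c => c'; exact: H.
have clsE x : (inner_prod x x = (cls x).1 :> int) /\ (weight x = (cls x).2).
  have wq := weight_le x; have /andP[i0 iw] := inner_prod_self_le x.
  rewrite /= !inordK ?ltnS //; first by split=> //; rewrite gez0_abs.
  by rewrite -lez_nat gez0_abs // (le_trans iw).
exists (c.1 : nat)%:Z, (c.2 : nat); split; first by rewrite -ltnS.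
rewrite -sum_weight (partition_big cls xpredT) //= -/(g _).
apply: (@le_trans _ _ (\sum_(c' : 'I_q.+1 * 'I_q.+1) g c)).
  by apply: ler_sum => c' _; exact: Hc.
rewrite sumr_const card_prod card_ord -[g c *+ _]mulr_natl natrM -expr2.
rewrite ler_wpM2l ?exprn_ge0 // /g mulr_natl -sumr_const big_mkcond [leRHS]big_mkcond.
apply: ler_sum => x _; rewrite finset.in_set.
case: eqP => [<-|_]; last by case: ifP => // _; rewrite exprn_ge0 // ltW.
by have [<- <-] := clsE x; rewrite !eqxx.
Qed.

(** * From words to points of the Euclidean space *)

Definition embed (R : realType) (n l p : nat) (x : {ffun 'I_n -> 'I_l}) : 'rV[R]_n :=
  \row_i ((alternating (x i))%:~R / Num.sqrt (2 * p%:R)).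

(** After scaling by sqrt(2 p) the squared distance is j = (N - <x, y>) / p: an integer by
    [div_adj], positive as x and y differ, and at most m as N - <x, y> <= B < (m + 1) p. *)
Lemma embed_dist (R : realType) (m n l p : nat) (N : int) (B : nat)
    (x y : {ffun 'I_n -> 'I_l}) :
  (0 < p)%N -> (B < m.+1 * p)%N ->
  inner_prod x x = N -> inner_prod y y = N -> weight x = B -> weight y = B ->
  x != y -> div_adj N p x y ->
  dist_graph (sqrt_dists R m) (embed R p x) (embed R p y).
Proof.
move=> p0 Bp xN yN xB yB xy /dvdzP[j zj].
have /andP[z0 zB] := inner_prod_bounds xN yN xB yB.
have zn0 : N - inner_prod x y != 0.
  by apply: contraNneq xy => z; apply/eqP; apply: inner_prod_eq xN yN z.
have j0 : 0 < j by rewrite zj in z0 zn0; nia.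
have jm : j < m.+1%:Z by rewrite zj in zB; nia.
have pR : (0 : R) < p%:R by rewrite ltr0n.
exists `|j|%N; first by rewrite /=; lia.
rewrite /enorm2; congr Num.sqrt.
have -> : \sum_(i < n) (embed R p x - embed R p y) 0 i ^+ 2 =
    (\sum_i (alternating (x i) - alternating (y i)) ^+ 2)%:~R / (2 * p%:R).
  rewrite rmorph_sum /= mulr_suml; apply: eq_bigr => i _; rewrite !mxE -mulrBl expr_div_n.
  by rewrite sqr_sqrtr ?mulr_ge0 // rmorphXn rmorphB.
rewrite sum_sqr_sub xN yN (_ : N + N - _ = 2 * j * p%:Z); last by rewrite -mulrA -zj; ring.
have p2 : (2 * p%:R : R) != 0 by rewrite mulf_neq0 ?gt_eqF.
have jE : j%:~R = `|j|%N%:R :> R by rewrite pmulrn gez0_abs // ltW.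
by apply: (mulIf p2); rewrite divfK // !rmorphM /= jE -!pmulrn; ring.
Qed.

(** More than k pairwise adjacent words of one color would embed as a forbidden clique, so
    [clique_bound] applies to each color. *)
Lemma coloring_bound (R : realType) (m k n l p c : nat) (N : int) (B : nat) :
  prime p -> (0 < l)%N -> (B < m.+1 * p)%N ->
  k_colorable (dist_graph (n := n) (sqrt_dists R m)) k c ->
  (#|[set x : {ffun 'I_n -> 'I_l} | (inner_prod x x == N) && (weight x == B)]| <=
   c * (k * #|[set e : {ffun 'I_n -> 'I_l} | \sum_i e i <= k * p.-1]|))%N.
Proof.
move=> pp l0 Bp [f Hf]; set X := [set x | _]; set D := (k * _)%N.
have XP x : x \in X -> inner_prod x x = N /\ weight x = B.
  by rewrite finset.in_set => /andP[/eqP ? /eqP ?].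
pose T a := [set x in X | f (embed R p x) == a].
have -> : #|X| = (\sum_a #|T a|)%N.
  rewrite -sum1_card (partition_big (fun x => f (embed R p x)) xpredT) //=.
  apply: eq_bigr => a _; rewrite -sum1_card; apply: eq_bigl => x.
  by rewrite [RHS]finset.in_set.
apply: (@leq_trans (\sum_(a < c) D)%N); last by rewrite sum_nat_const card_ord.
apply: leq_sum => a _; set S := T a.
have SX x : x \in S -> x \in X by rewrite finset.in_set => /andP[].
apply: (@clique_bound n l p k N S pp l0); first by move=> x /SX /XP[].
move=> C CS clC; rewrite leqNgt; apply/negP => kC; apply: (Hf a).
pose g (i : 'I_k.+1) := enum_val (widen_ord kC i).
have gC i : g i \in C by apply: enum_valP.
have gS i : g i \in S by apply: (fintype.subsetP CS).
have ginj : injective g.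
  by move=> i j /enum_val_inj /(congr1 val) /= /val_inj.
have edge i j : i != j ->
    dist_graph (sqrt_dists R m) (embed R p (g i)) (embed R p (g j)).
  move=> ij; have [iN iB] := XP _ (SX _ (gS i)); have [jN jB] := XP _ (SX _ (gS j)).
  have gij : g i != g j by apply: contraNneq ij => /ginj ->.
  apply: (embed_dist R (prime_gt0 pp) Bp iN jN iB jB gij).
  by move: clC => /forall_inP/(_ _ (gC i))/forall_inP/(_ _ (gC j))/implyP; apply.
exists (fun i => embed R p (g i)); split => //.
  (* Edges have positive length, so the embedding is injective on the clique. *)
  move=> i j; have [//|ij] := eqVneq i j.
  have := edge i j ij; rewrite /dist_graph => -[q /= /andP[q1 _]] + eij.
  rewrite eij subrr /enorm2 big1 ?sqrtr0; last by move=> i' _; rewrite mxE expr0n.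
  by move/eqP; rewrite sqrtr_eq0 leNgt ltr0n q1.
by move=> i; have := gS i; rewrite finset.in_set => /andP[_ /eqP].
Qed.

(** * Asymptotics *)

Lemma theta_truncE (R : realType) (t : R) (l : nat) :
  theta_trunc t l = \sum_(j < l) t ^+ 'C(j.+1, 2).
Proof. by rewrite /theta_trunc big_add1 /= big_mkord. Qed.

Lemma geometric_ge1 (R : realType) (t : R) (l : nat) :
  0 <= t -> (0 < l)%N -> 1 <= \sum_(0 <= i < l) t ^+ i.
Proof.
case: l => // l t0 _; rewrite big_nat_recl // expr0 lerDl.
by apply: sumr_ge0 => i _; exact: exprn_ge0.
Qed.

Lemma theta_trunc_bounds (R : realType) (t : R) (l : nat) :
  0 <= t -> t <= 1 -> (0 < l)%N -> 1 <= theta_trunc t l <= l%:R.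
Proof.
move=> t0 t1 l0; rewrite theta_truncE; apply/andP; split.
  case: l l0 => // l _; rewrite big_ord_recl /= expr0 lerDl.
  by apply: sumr_ge0 => i _; exact: exprn_ge0.
rewrite -[X in _ <= X%:R]card_ord -sumr_const.
by apply: ler_sum => j _; apply: exprn_ile1.
Qed.

Lemma powR_in01 (R : realType) (t a : R) : 0 < t < 1 -> 0 <= a -> 0 < t `^ a <= 1.
Proof.
move=> /andP[t0 t1] a0; rewrite powR_gt0 //=.
by rewrite -(powRr0 t) ger_powR // t0 ltW.
Qed.

Lemma theta_ratio_bounds (R : realType) (m k l : nat) (t : R) : 0 < t < 1 -> (0 < l)%N ->
  0 < theta_ratio m k l t <= l%:R.
Proof.
move=> t01 l0; have /andP[t0 t1] := t01.
have g1 := geometric_ge1 (ltW t0) l0.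
have g0 : 0 < \sum_(0 <= i < l) t ^+ i by lra.
have /andP[s0 s1] := @powR_in01 R t (k%:R / m.+1%:R) t01 ltac:(by rewrite divr_ge0).
have /andP[h1 h2] := theta_trunc_bounds (ltW s0) s1 l0.
rewrite /theta_ratio; apply/andP; split; first by rewrite divr_gt0 //; lra.
by rewrite ler_pdivrMr //; apply: le_trans h2 _; rewrite ler_peMr.
Qed.

(** Up to polynomial factors there are theta^n / s^B words and at most sig^n / t^(k p) monomials.
    Since s^B = t^(k B / (m + 1)), these powers nearly cancel for p close to B / (m + 1); [t ^ del]
    absorbs the relative excess of p. *)
Lemma colorable_ge (R : realType) (m k l : nat) (t del : R) :
  (0 < k)%N -> (0 < l)%N -> 0 < t < 1 -> 0 < del ->
  exists2 C : R, 0 < C & forall n c,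
  k_colorable (dist_graph (n := n) (sqrt_dists R m)) k c ->
  (theta_ratio m k l t * t `^ del) ^+ n <= C * n.+1%:R ^+ 2 * c%:R.
Proof.
move=> k0 l0 t01 d0; have /andP[t0 t1] := t01.
have kR : (0 : R) < k%:R by rewrite ltr0n.
have lR : (0 : R) < (l ^ 2)%:R by rewrite ltr0n expn_gt0 l0.
have mR : (0 : R) < m.+1%:R by rewrite ltr0n.
(* As B <= n l^2, a relative excess e of p over B / (m + 1) adds at most n del to the exponent of
   t. *)
pose e := Order.min 1 (del / (k%:R * (l ^ 2)%:R)).
have e0 : 0 < e by rewrite lt_min ltr01 divr_gt0 // mulr_gt0.
have e1 : e <= 1 by rewrite ge_min lexx.
have ed : k%:R * (e * (l ^ 2)%:R) <= del.
  have : e <= del / (k%:R * (l ^ 2)%:R) by rewrite ge_min lexx orbT.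
  by rewrite ler_pdivlMr ?mulr_gt0 //; lra.
have [X X0 HX] := prime_in_short_interval e0.
pose a := k%:R / m.+1%:R : R.
have a0 : 0 <= a by rewrite divr_ge0.
pose s := t `^ a; have /andP[s0 s1] := powR_in01 t01 a0.
(* If B / (m + 1) is below X, the prime is only known to be at most 2 X; A covers this case. *)
pose A := k%:R * (2 * X%:R) : R.
have tA : 0 < t `^ A by rewrite powR_gt0.
exists ((l ^ 2).+1%:R ^+ 2 * k%:R / t `^ A).
  by rewrite divr_gt0 // mulr_gt0 // exprn_gt0.
move=> n c col; set sig := \sum_(0 <= i < l) t ^+ i.
have sig0 : 0 < sig by apply: lt_le_trans (geometric_ge1 (ltW t0) l0).
have [N [B [Bn heavy]]] := heavy_sphere n l s0.
have [p [pp Np pN]] := HX (maxn X (B %/ m.+1)) (leq_maxl _ _).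
have Bp : (B < m.+1 * p)%N.
  by rewrite mulnC -ltn_divLR // (leq_ltn_trans _ Np) // leq_maxr.
have := coloring_bound N pp l0 Bp col.
have := @card_low_degree R n l (k * p.-1) t t0 (ltW t1).
set D := #|[set e : {ffun _} | _]|; rewrite -(big_mkord xpredT (fun j => t ^+ j)) -/sig => HD.
set x := #|_| in heavy * => Hx.
rewrite -theta_truncE -/(theta_ratio _ _ _ _) in heavy.
have {heavy} heavy : theta_trunc s l ^+ n * t ^+ (k * p) <=
    (n * l ^ 2).+1%:R ^+ 2 * (c%:R * k%:R * s ^+ B) * sig ^+ n.
  apply: le_trans (ler_wpM2r (exprn_ge0 _ (ltW t0)) heavy) _.
  rewrite -[leLHS]mulrA -[leRHS]mulrA ler_wpM2l ?exprn_ge0 // -!mulrA.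
  apply: (@le_trans _ _ ((c%:R * (k%:R * D%:R)) * (s ^+ B * t ^+ (k * p)))).
    rewrite ler_wpM2r ?mulr_ge0 ?exprn_ge0 ?(ltW s0) ?(ltW t0) //.
    by rewrite -!natrM ler_nat.
  rewrite -!mulrA !ler_wpM2l //.
  rewrite mulrCA ler_wpM2l ?exprn_ge0 ?(ltW s0) //.
  apply: le_trans HD; rewrite ler_wpM2l // ler_wiXn2l ?(ltW t0) ?(ltW t1) //.
  by rewrite leq_mul2l leq_pred orbT.
(* In exponents of t this is k p <= A + k B / (m + 1) + n del. *)
have tp : t `^ A * s ^+ B * (t `^ del) ^+ n <= t ^+ (k * p).
  rewrite -!powR_mulrn ?powR_ge0 ?(ltW t0) // -!powRrM -!powRD ?(gt_eqF t0) ?implybT //.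
  apply: ger_powR; first by rewrite t0 ltW.
  have Bq : (B %/ m.+1)%:R <= B%:R / m.+1%:R :> R.
    by rewrite ler_pdivlMr // -natrM ler_nat leq_trunc_div.
  have Bm : B%:R / m.+1%:R <= n%:R * (l ^ 2)%:R :> R.
    rewrite ler_pdivrMr // -!natrM ler_nat; apply: leq_trans Bn _.
    by rewrite leq_pmulr.
  have pM : p%:R <= 2 * X%:R + B%:R / m.+1%:R + e * (n%:R * (l ^ 2)%:R).
    have b0 : 0 <= B%:R / m.+1%:R :> R by rewrite divr_ge0.
    move: (B%:R / m.+1%:R) Bq Bm b0 => b Bq Bm b0.
    have h1 : e * b <= e * (n%:R * (l ^ 2)%:R) by rewrite ler_wpM2l // ltW.
    have h2 : e * X%:R <= X%:R by rewrite ler_piMl.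
    have [XB|BX] := leqP X (B %/ m.+1).
      move: pN; rewrite (maxn_idPr XB) => pN.
      have h3 : (1 + e) * (B %/ m.+1)%:R <= (1 + e) * b.
        by rewrite ler_wpM2l //; lra.
      have : (0 : R) <= X%:R by [].
      by lra.
    move: pN; rewrite (maxn_idPl (ltnW BX)) => pN.
    have : 0 <= e * (n%:R * (l ^ 2)%:R) by rewrite !mulr_ge0 // ltW.
    by lra.
  rewrite natrM; apply: le_trans (ler_wpM2l (ltW kR) pM) _.
  have h4 : n%:R * (k%:R * (e * (l ^ 2)%:R)) <= n%:R * del by rewrite ler_wpM2l.
  have -> : a * B%:R = k%:R * (B%:R / m.+1%:R) by rewrite /a mulrAC mulrA.
  by move: (B%:R / m.+1%:R) => b; rewrite /A; lra.
have sB0 : 0 < s ^+ B by rewrite exprn_gt0.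
have Q1 : (n * l ^ 2).+1%:R <= (l ^ 2).+1%:R * n.+1%:R :> R.
  by rewrite -natrM ler_nat mulSn mulnS addnA -add1n mulnC leq_add2r.
have th0 : 0 <= theta_trunc s l ^+ n.
  rewrite exprn_ge0 //; have /andP[h _] := theta_trunc_bounds (ltW s0) s1 l0; lra.
have tp' := le_trans (ler_wpM2l th0 tp) heavy.
have key : (theta_trunc s l * t `^ del) ^+ n * t `^ A <=
    (n * l ^ 2).+1%:R ^+ 2 * (c%:R * k%:R) * sig ^+ n.
  rewrite -(ler_pM2r sB0) exprMn; move: tp'.
  by congr (_ <= _); ring.
rewrite /theta_ratio -/a -/s -/sig mulrAC expr_div_n ler_pdivrMr ?exprn_gt0 //.
have {key} key : (theta_trunc s l * t `^ del) ^+ n <=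
    (n * l ^ 2).+1%:R ^+ 2 * (c%:R * k%:R) * sig ^+ n / t `^ A.
  by rewrite ler_pdivlMr.
apply: le_trans key _.
have Q2 : (n * l ^ 2).+1%:R ^+ 2 <= ((l ^ 2).+1%:R * n.+1%:R) ^+ 2 :> R.
  by rewrite lerXn2r ?nnegrE ?mulr_ge0.
have -> : (l ^ 2).+1%:R ^+ 2 * k%:R / t `^ A * n.+1%:R ^+ 2 * c%:R * sig ^+ n =
   ((l ^ 2).+1%:R * n.+1%:R) ^+ 2 * (c%:R * k%:R) * sig ^+ n / t `^ A :> R by rewrite exprMn; ring.
rewrite ler_wpM2r ?invr_ge0 ?(ltW tA) // ler_wpM2r ?exprn_ge0 ?(ltW sig0) //.
by rewrite ler_wpM2r // mulr_ge0.
Qed.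

(** For the chosen h, q >= (1 + h)^3, and Bernoulli's inequality gives (1 + h)^(3 n) >= ((n + 1)
    h)^3, one power of n + 1 to spare. *)
Lemma poly_le_expr (R : realType) (q C : R) : 1 < q -> 0 < C ->
  exists n0, forall n, (n0 <= n)%N -> C * n.+1%:R ^+ 2 <= q ^+ n.
Proof.
move=> q1 C0; pose h := Order.min 1 ((q - 1) / 7).
have h0 : 0 < h by rewrite lt_min ltr01 divr_gt0 // subr_gt0.
have h1 : h <= 1 by rewrite ge_min lexx.
have hq : 7 * h <= q - 1.
  by have : h <= (q - 1) / 7; [rewrite ge_min lexx orbT | lra].
have q3 : (1 + h) ^+ 3 <= q by rewrite !exprS expr0; nra.
have bern n : 1 + n%:R * h <= (1 + h) ^+ n.
  elim: n => [|n IH]; first by rewrite mul0r addr0 expr0.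
  have : 0 <= n%:R * h by rewrite mulr_ge0 // ltW.
  by rewrite exprS -natr1; nra.
have h3 : 0 < h ^+ 3 by rewrite exprn_gt0.
exists (Num.truncn (C / h ^+ 3)).+1 => n n0.
have Cn : C <= n.+1%:R * h ^+ 3.
  rewrite -ler_pdivrMr //; apply: (le_trans (ltW (truncnS_gt _))).
  by rewrite ler_nat ltnW.
have nh : n.+1%:R * h <= (1 + h) ^+ n by apply: le_trans (bern n); rewrite -natr1; lra.
apply: (@le_trans _ _ ((n.+1%:R * h) ^+ 3)).
  rewrite exprMn [_ ^+ 3]exprSr -mulrA mulrC ler_wpM2l ?exprn_ge0 //.
apply: (@le_trans _ _ (((1 + h) ^+ n) ^+ 3)).
  rewrite lerXn2r // nnegrE ?mulr_ge0 ?exprn_ge0 //; lra.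
rewrite -exprM mulnC exprM lerXn2r // nnegrE ?exprn_ge0 //; lra.
Qed.

Lemma theta_max_has_sup (R : realType) (m k l : nat) : (0 < l)%N ->
  has_sup [set theta_ratio m k l t | t in [set t : R | 0 < t < 1]]%classic.
Proof.
move=> l0; split.
  by exists (theta_ratio m k l (2^-1 : R)); exists (2^-1 : R) => //=; apply/andP; split; lra.
by exists l%:R => _ [t /= t01 <-]; have /andP[] := @theta_ratio_bounds R m k l t t01 l0.
Qed.

Lemma theta_max_gt0 (R : realType) (m k l : nat) : (0 < l)%N -> 0 < theta_max R m k l.
Proof.
move=> l0; have h : 0 < (2^-1 : R) < 1 by apply/andP; split; lra.
have /andP[r0 _] := @theta_ratio_bounds R m k l _ h l0.
apply: lt_le_trans r0 _; apply: ub_le_sup; first by case: (@theta_max_has_sup R m k l l0).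
by exists (2^-1 : R).
Qed.

Lemma colorable_ge_eventually (R : realType) (m k l : nat) (w : R) :
  (0 < k)%N -> (0 < l)%N -> 0 < w -> w < theta_max R m k l ->
  exists n0, forall n c, (n0 <= n)%N ->
  k_colorable (dist_graph (n := n) (sqrt_dists R m)) k c -> w ^+ n <= c%:R.
Proof.
move=> k0 l0 w0 wmax.
have d0 : 0 < theta_max R m k l - w by rewrite subr_gt0.
have [_ [t /= t01 <-] rw] := sup_adherent d0 (@theta_max_has_sup R m k l l0).
rewrite -/(theta_max _ _ _ _) subKr in rw.
set r := theta_ratio m k l t in rw; have /andP[t0 t1] := t01.
have r0 : 0 < r by lra.
have wr0 : 0 < w / r by rewrite divr_gt0.
have lwr : ln (w / r) < 0 by apply: ln_lt0; rewrite wr0 ltr_pdivrMr // mul1r.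
have lt0 : ln t < 0 by apply: ln_lt0.
(* With this choice t^del = sqrt(w / r), so the base of [colorable_ge] exceeds w by the factor
   sqrt(r / w), which beats the polynomial loss. *)
pose del := ln (w / r) / (2 * ln t).
have del0 : 0 < del by rewrite /del ltr_ndivlMr ?mul0r //; lra.
have q1 : 1 < r * t `^ del / w.
  rewrite ltr_pdivlMr // mul1r -ltr_pdivrMl // mulrC.
  have tp : 0 < t `^ del by rewrite powR_gt0.
  rewrite -ltr_ln ?posrE // ln_powR /del.
  have -> : ln (w / r) / (2 * ln t) * ln t = ln (w / r) / 2.
    by field; rewrite lt_eqF.
  by lra.
have [C C0 HC] := colorable_ge m k0 l0 t01 del0.
have [n0 Hn0] := poly_le_expr q1 C0.
exists n0 => n c nn col.
have := le_trans (HC n c col) (ler_wpM2r _ (Hn0 n nn)).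
rewrite expr_div_n -/r => /(_ (ler0n _ _)) h.
have P0 : 0 < (r * t `^ del) ^+ n by rewrite exprn_gt0 // mulr_gt0 // powR_gt0.
by move: h; rewrite [leRHS]mulrAC ler_pdivlMr ?exprn_gt0 // ler_pM2l.
Qed.

Lemma colorable_gt0 (V : Type) (E : V -> V -> Prop) (k c : nat) (v : V) :
  k_colorable E k c -> (0 < c)%N.
Proof. by case=> f _; apply: leq_ltn_trans (ltn_ord (f v)). Qed.

Local Open Scope classical_set_scope.

Theorem theorem1p3 (R : realType) (m : nat) (hm : (1 <= m)%N)
    (l : nat) (hl : (1 < l)%N) (k : nat) (hk : (1 <= k)%N) :
  exists eps : nat -> R,
    eps @ \oo --> (0 : R) /\
    forall n : nat,
      (((theta_max R m k l + eps n) ^+ n)%:E <= chi_k_Rn k n (sqrt_dists R m))%E.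
Proof.
have l0 : (0 < l)%N by apply: ltnW.
set th := theta_max R m k l.
have th0 : 0 < th by apply: theta_max_gt0.
(* Here d is an admissible loss in dimension n; d <= th keeps the base nonnegative, so that n-th
   powers compare. *)
pose ok n (d : R) := [/\ 0 <= d, d <= th & forall c,
  k_colorable (dist_graph (n := n) (sqrt_dists R m)) k c -> (th - d) ^+ n <= c%:R].
(* The loss th always works: 0^n <= 1, and at least one color is needed. *)
have ok_th n : ok n th.
  split=> // [|c col]; first exact: ltW.
  apply: (@le_trans _ _ 1); last by rewrite ler1n (colorable_gt0 0 col).
  by rewrite subrr; case: n {col} => [|n]; rewrite ?expr0 // expr0n.
pose A n := [set d | ok n d].
have infA n : has_inf (A n) by split; [exists th; exact: ok_th | exists 0 => d []].
have inf0 n : 0 <= inf (A n) by apply: lb_le_inf => [|d []//]; exists th; exact: ok_th.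
(* The term 1 / (n + 1) lifts the value above some admissible loss, whether or not the infimum is
   attained; the minimum with th keeps the base nonnegative. *)
pose eps n : R := - Order.min th (inf (A n) + n.+1%:R^-1).
have n0 n : (0 : R) < n.+1%:R^-1 by rewrite invr_gt0.
exists eps; split; last first.
  move=> n; rewrite /chi_k_Rn /chi_k; apply: le_ereal_inf_tmp => _ [c /= col <-].
  rewrite lee_fin /eps -/th.
  have [d [d0 dth Hd] dinf] := inf_adherent (n0 n) (infA n).
  apply: le_trans (Hd c col); apply: lerXn2r; rewrite ?nnegrE ?subr_ge0 //.
    by rewrite ge_min lexx.
  by rewrite lerD2l lerN2 le_min dth ltW.
apply/cvgrPdist_le => e e0.
(* One half of e is for the infimum, the other for 1 / (n + 1); th / 2 keeps th - d positive. *)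
pose d := Order.min (e / 2) (th / 2).
have d0 : 0 < d by rewrite lt_min !divr_gt0.
have dth : d < th by rewrite gt_min; apply/orP; right; lra.
have de : d <= e / 2 by rewrite ge_min lexx.
have w0 : 0 < th - d by rewrite subr_gt0.
have wth : th - d < theta_max R m k l by rewrite -/th; lra.
have [N1 HN1] := colorable_ge_eventually hk l0 w0 wth.
exists (maxn N1 (Num.truncn (2 / e)).+1) => // n /=; rewrite geq_max => /andP[nN1 n2].
have infd : inf (A n) <= d.
  by apply: ge_inf; [case: (infA n) | split=> [||c]; [exact: ltW | exact: ltW | exact: HN1]].
have ne : n.+1%:R^-1 <= e / 2.
  rewrite -[leRHS]invrK lef_pV2 ?posrE ?invr_gt0 ?divr_gt0 // invf_div.
  by apply: (le_trans (ltW (truncnS_gt _))); rewrite ler_nat ltnW.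
rewrite /eps sub0r opprK ger0_norm; last by rewrite le_min ltW //= addr_ge0 // ltW.
by rewrite ge_min; apply/orP; right; apply: le_trans (lerD infd ne) _; lra.
Qed.
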